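(* The $\mathsf{Broadcast}$ problem on an $n$-vertex network of maximum degree $\Delta$ can be solved by a randomized algorithm with high probability with the following running time $T(n,\Delta)$ and energy cost $E(n,\Delta)$: in $\mathsf{LOCAL}$, $T=O(n\log n)$ and $E=O(\log n)$; in $\mathsf{CD}$, $T=O(n\log\Delta\log^2 n)$ and $E=O(\log^2 n)$; in $\mathsf{No}\text{-}\mathsf{CD}$, $T=O(n\log\Delta\log^2 n)$ and $E=O(\log\Delta\log^2 n)$.
   Context: Radio network model: connected undirected graph $G=(V,E)$, $n=|V|$, maximum degree $\Delta$, with $n,\Delta$ known to the vertices but not the topology; synchronized slots; each vertex transmits, listens or idles per slot; transmit/listen cost one unit of energy; energy of an algorithm = maximum over vertices of transmit/listen slots. $\mathsf{LOCAL}$: listeners hear all transmitting neighbors. $\mathsf{No}\text{-}\mathsf{CD}$: a listener receives a message iff exactly one neighbor transmits, otherwise silence. $\mathsf{CD}$: as $\mathsf{No}\text{-}\mathsf{CD}$ but two or more transmitters produce noise distinguishable from silence. Randomized algorithms use private random bits; ''with high probability'' = failure probability $\le1/\mathrm{poly}(n)$. $\mathsf{Broadcast}$: a source vertex holds a message that all vertices must learn. *)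

(* Defs.v *)
From mathcomp Require Import all_boot.
Set Implicit Arguments. Unset Strict Implicit. Unset Printing Implicit Defensive.

Inductive radio_model := LOCAL | CD | NoCD.

Inductive action (P : Type) := Transmit of P | Listen | Idle.
Arguments Listen {P}. Arguments Idle {P}.

(* What a vertex observes at the end of a slot.
   FNothing : the vertex transmitted or idled (it learns nothing);
   FSilence / FNoise / FMsg p : No-CD and CD listeners;
   FHeard s : LOCAL listener hears the multiset s of all packets sent by
              transmitting neighbours (see [upd_perm] below). *)
Inductive feedback (P : Type) :=
  FNothing | FSilence | FNoise | FMsg of P | FHeard of seq P.
Arguments FNothing {P}. Arguments FSilence {P}. Arguments FNoise {P}.

(* A randomized distributed algorithm for Broadcast of a message of type Msg.
   All vertices run the same code; a vertex initially knows only n, Delta,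
   its own private random bits, and (if it is the source) the message.
   The algorithm runs for [rounds n Delta] slots; each vertex gets
   [rbits n Delta] independent uniform random bits. *)
Record algorithm (Msg : Type) := Algorithm {
  State : Type;
  Packet : eqType;
  rbits : nat -> nat -> nat;
  rounds : nat -> nat -> nat;
  init : nat -> nat -> seq bool -> option Msg -> State;
  act : State -> action Packet;
  upd : State -> feedback Packet -> State;
  out : State -> option Msg;
  (* LOCAL listeners receive a multiset: the order is irrelevant. *)
  upd_perm : forall st s1 s2, perm_eq s1 s2 -> upd st (FHeard s1) = upd st (FHeard s2)
}.

Section Execution.
Variables (Msg : Type) (A : algorithm Msg) (mdl : radio_model).
Variables (n Delta : nat) (e : rel 'I_n) (s : 'I_n) (m : Msg).
Variable rnd : 'I_n -> seq bool.

Definition tx_of (st : State A) : option (Packet A) :=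
  if act st is Transmit p then Some p else None.

Definition incoming (cur : 'I_n -> State A) (v : 'I_n) : seq (Packet A) :=
  pmap (fun u => if e v u then tx_of (cur u) else None) (enum 'I_n).

Definition channel (txs : seq (Packet A)) : feedback (Packet A) :=
  match mdl with
  | LOCAL => FHeard txs
  | NoCD => if txs is [:: p] then FMsg p else FSilence
  | CD => match txs with [::] => FSilence | [:: p] => FMsg p | _ => FNoise end
  end.

Definition feedback_of (cur : 'I_n -> State A) (v : 'I_n) : feedback (Packet A) :=
  if act (cur v) is Listen then channel (incoming cur v) else FNothing.

Fixpoint exec (t : nat) : 'I_n -> State A :=
  match t with
  | 0 => fun v => init A n Delta (rnd v) (if v == s then Some m else None)
  | t'.+1 => let cur := exec t' in fun v => upd (cur v) (feedback_of cur v)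
  end.

Definition energy (T : nat) (v : 'I_n) : nat :=
  \sum_(t < T) (if act (exec t v) is Idle then 0 else 1).

End Execution.

Definition lg (x : nat) : nat := up_log 2 x.

Definition graph_ok (n Delta : nat) (e : rel 'I_n) : Prop :=
  symmetric e /\ irreflexive e /\ (forall u v, connect e u v) /\
  \max_(v : 'I_n) #|[set u | e v u]| = Delta.

(* Broadcast is solved in model [mdl], with high probability (failure
   probability <= n^-k for any prescribed constant k), in time O(T n Delta)
   and energy O(E n Delta).  The probability space is the uniform
   distribution over the private random bit strings of all vertices. *)
Definition broadcast_whp (mdl : radio_model) (T E : nat -> nat -> nat) : Prop :=
  forall k : nat, exists c N0 : nat, forall Msg : eqType, exists A : algorithm Msg,
  forall n Delta : nat, N0 <= n ->
    rounds A n Delta <= c * T n Delta /\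
    forall (e : rel 'I_n) (s : 'I_n) (m : Msg), graph_ok Delta e ->
      (forall (rnd : {ffun 'I_n -> (rbits A n Delta).-tuple bool}) (v : 'I_n),
         energy A mdl Delta e s m (fun u => tval (rnd u)) (rounds A n Delta) v
           <= c * E n Delta) /\
      #|[set rnd : {ffun 'I_n -> (rbits A n Delta).-tuple bool} |
          ~~ [forall v, out (exec A mdl Delta e s m (fun u => tval (rnd u))
                               (rounds A n Delta) v) == Some m]]| * n ^ k
        <= #|{ffun 'I_n -> (rbits A n Delta).-tuple bool}|.

(* Main.v *)
(* Every vertex carries a label so that a vertex with a positive label has a
   neighbour whose label is smaller by one; initially all labels are 0.  A wave
   starting from some vertices that travels down the labels, once across all
   edges, up, and down again costs each vertex at most 7 local broadcasts, since
   it takes part only when its own label or an adjacent one is served.  In one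
   iteration every root (label 0) tosses a coin, the wave starts from the roots
   showing heads, roots not reached start a wave of their own before the last
   descent, and the hop counts become the new labels.  If there are two roots,
   each root is connected by the wave to some other root, hence disappears with
   probability at least 1/4.  After O(log n) iterations one root remains, and a
   wave starting from the source reaches all vertices.

   A local broadcast takes one slot in LOCAL.  In the other models an epoch has
   one slot for each level i < log Delta, and each sender picks level i with
   probability 2^-(i+1).  A No-CD receiver listens to all levels; a CD receiver
   listens to one level per epoch and moves to the next sparser or denser level
   upon noise or silence: a biased random walk, which finds the right level in
   O(log n) epochs. *)
Require Import Defs.
From Stdlib Require Import ClassicalEpsilon FunctionalExtensionality.
From mathcomp Require Import all_boot all_order all_algebra.
From mathcomp Require Import zify ring lra.
Set Implicit Arguments. Unset Strict Implicit. Unset Printing Implicit Defensive.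
Import Order.TTheory GRing.Theory Num.Theory.

(** * Synchronous programs *)

Section Programs.
Variable P : eqType.

(** The exact number of slots is part of the type, so all vertices stay in lockstep whatever they
    hear. *)
Fixpoint prog (A : Type) (B : nat) : Type :=
  if B is B'.+1 then (action P * (feedback P -> prog A B'))%type else A.

Fixpoint bind A C B1 B2 : prog A B1 -> (A -> prog C B2) -> prog C (B1 + B2) :=
  match B1 return prog A B1 -> (A -> prog C B2) -> prog C (B1 + B2) with
  | 0 => fun p k => k p
  | B.+1 => fun p k => (p.1, fun f => bind (p.2 f) k)
  end.

Fixpoint mapp A C (g : A -> C) B : prog A B -> prog C B :=
  match B return prog A B -> prog C B with
  | 0 => g
  | B'.+1 => fun p => (p.1, fun f => mapp g (p.2 f))
  end.

Fixpoint epoch (plan : nat -> action P) j B : prog (seq (feedback P)) B :=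
  match B return prog (seq (feedback P)) B with
  | 0 => [::]
  | B'.+1 => (plan j, fun f => mapp (cons f) (epoch plan j.+1 B'))
  end.

Fixpoint loop X O b B (body : O -> seq bool -> X -> prog X B) (os : seq O)
    (bits : seq bool) (x : X) : prog X (size os * B) :=
  match os return prog X (size os * B) with
  | [::] => x
  | o :: os' => bind (body o (take b bits) x) (loop b body os' (drop b bits))
  end.

Definition cost (a : action P) : nat := if a is Idle then 0 else 1.

Definition listens (a : action P) : bool := if a is Listen then true else false.

Definition transmits (a : action P) : bool := if a is Transmit _ then true else false.

(** Quantifying over every possible feedback gives a worst-case bound for a single vertex that does
    not mention the network. The postcondition [Q] lets the cost of the next phase depend on the
    result of this one. *)
Fixpoint spends A B (c : nat) (Q : A -> Prop) : prog A B -> Prop :=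
  match B return prog A B -> Prop with
  | 0 => Q
  | B'.+1 => fun p => cost p.1 <= c /\ forall f, spends (c - cost p.1) Q (p.2 f)
  end.

Lemma spends_weaken A B c c' (Q Q' : A -> Prop) (p : prog A B) :
  c <= c' -> (forall a, Q a -> Q' a) -> spends c Q p -> spends c' Q' p.
Proof.
elim: B c c' p => [|B IH] c c' p lcc QQ' /=; first exact: QQ'.
case=> lc Hp; split=> [|f]; first exact: leq_trans lc lcc.
by apply: IH (Hp f) => //; apply: leq_sub2r.
Qed.

Lemma spends_bind A C B1 B2 c1 c2 (Q1 : A -> Prop) (Q2 : C -> Prop)
    (p : prog A B1) (k : A -> prog C B2) :
  spends c1 Q1 p -> (forall a, Q1 a -> spends c2 Q2 (k a)) ->
  spends (c1 + c2) Q2 (bind p k).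
Proof.
elim: B1 c1 p => [|B IH] c1 p /= Hp Hk.
  by apply: spends_weaken (Hk _ Hp) => //; apply: leq_addl.
case: Hp => lc Hp; split=> [|f]; first exact: leq_trans lc (leq_addr _ _).
by rewrite -addnBAC //; apply: IH (Hp f) Hk.
Qed.

Lemma spends_mapp A C B c (Q : C -> Prop) (g : A -> C) (p : prog A B) :
  spends c (fun a => Q (g a)) p -> spends c Q (mapp g p).
Proof.
by elim: B c p => [|B IH] c p //= [lc Hp]; split=> // f; apply: IH.
Qed.

Lemma spends_epoch plan j B :
  spends (\sum_(i <- iota j B) cost (plan i)) (fun=> True) (epoch plan j B).
Proof.
elim: B j => [|B IH] j //=.
rewrite big_cons; split=> [|f]; first exact: leq_addr.
by rewrite addKn; apply: spends_mapp; apply: IH.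
Qed.

Lemma spends_loop X O b B (body : O -> seq bool -> X -> prog X B) (Q : X -> Prop)
    (c : O -> nat) os bits x :
  (forall o bits x, Q x -> spends (c o) Q (body o bits x)) -> Q x ->
  spends (\sum_(o <- os) c o) Q (loop b body os bits x).
Proof.
move=> Hb; elim: os bits x => [|o os IH] bits x Qx //=.
by rewrite big_cons; apply: spends_bind (Hb _ _ _ Qx) _ => a; apply: IH.
Qed.

(* Chosen from the set of packets heard, hence independent of their order, as
   [upd_perm] demands. *)
Definition some_packet (Q : P -> Prop) : option P :=
  match excluded_middle_informative (exists p, Q p) with
  | left h => Some (proj1_sig (constructive_indefinite_description _ h))
  | right _ => None
  end.

(** Cutting the multiset down to one packet gives LOCAL the same interface as the radio models: a
    packet or silence. *)
Definition single_out (f : feedback P) : feedback P :=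
  if f is FHeard s then
    (if some_packet (fun p => p \in s) is Some p then FMsg p else FSilence)
  else f.

Lemma single_out_perm s1 s2 :
  perm_eq s1 s2 -> single_out (FHeard s1) = single_out (FHeard s2).
Proof.
move=> /perm_mem s12; rewrite /single_out.
suff -> : (fun p => is_true (p \in s1)) = (fun p => is_true (p \in s2)) by [].
by apply: functional_extensionality => p; rewrite s12.
Qed.

Variables (mdl : radio_model) (n : nat) (e : rel 'I_n).

Definition packets (a : 'I_n -> action P) (v : 'I_n) : seq P :=
  pmap (fun u => if e v u then (if a u is Transmit p then Some p else None)
                 else None) (enum 'I_n).

Definition hear (txs : seq P) : feedback P :=
  match mdl with
  | LOCAL => single_out (FHeard txs)
  | NoCD => if txs is [:: p] then FMsg p else FSilence
  | CD => match txs with [::] => FSilence | [:: p] => FMsg p | _ => FNoise end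
  end.

Definition fb (a : 'I_n -> action P) (v : 'I_n) : feedback P :=
  if a v is Listen then hear (packets a v) else FNothing.

Fixpoint run A B : ('I_n -> prog A B) -> 'I_n -> A :=
  match B return ('I_n -> prog A B) -> 'I_n -> A with
  | 0 => id
  | B'.+1 => fun p => run (fun v => (p v).2 (fb (fun u => (p u).1) v))
  end.

Lemma run_bind A C B1 B2 (p : 'I_n -> prog A B1) (k : 'I_n -> A -> prog C B2) :
  run (fun v => bind (p v) (k v)) = run (fun v => k v (run p v)).
Proof. elim: B1 p => [|B IH] p //; exact: IH. Qed.

Lemma run_mapp A C B (p : 'I_n -> prog A B) (g : 'I_n -> A -> C) :
  run (fun v => mapp (g v) (p v)) = fun v => g v (run p v).
Proof. elim: B p => [|B IH] p //; exact: IH. Qed.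

Lemma run_epoch (plan : 'I_n -> nat -> action P) j B :
  run (fun v => epoch (plan v) j B) =
  fun v => [seq fb (fun u => plan u i) v | i <- iota j B].
Proof.
elim: B j => [|B IH] j //.
apply: functional_extensionality => v.
change (run (fun v => mapp (cons (fb (fun u => plan u j) v))
  (epoch (plan v) j.+1 B)) v = [seq fb (fun u => plan u i) v | i <- iota j B.+1]).
by rewrite run_mapp IH.
Qed.

(** The counterpart of [loop] for the whole network: a round acts on all vertices at once and
    consumes the next [b] bits of each. *)
Fixpoint nloop X O b (body : O -> ('I_n -> seq bool) -> ('I_n -> X) -> 'I_n -> X)
    (os : seq O) (w : 'I_n -> seq bool) (x : 'I_n -> X) : 'I_n -> X :=
  if os is o :: os' then
    nloop b body os' (fun v => drop b (w v)) (body o (fun v => take b (w v)) x)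
  else x.

Lemma nloop_inv X O b (inv : ('I_n -> X) -> Prop)
    (body : O -> ('I_n -> seq bool) -> ('I_n -> X) -> 'I_n -> X) os w x :
  (forall o w x, inv x -> inv (body o w x)) -> inv x -> inv (nloop b body os w x).
Proof. by move=> Hb; elim: os w x => //= o os IH w x ix; apply: IH; apply: Hb. Qed.

Lemma run_loop X O b B (body : 'I_n -> O -> seq bool -> X -> prog X B) os w x :
  run (fun v => loop b (body v) os (w v) (x v)) =
  nloop b (fun o w x => run (fun v => body v o (w v) (x v))) os w x.
Proof.
elim: os w x => [|o os IH] w x //=.
by rewrite run_bind -IH.
Qed.

Lemma packetsP a v p :
  reflect (exists2 u, e v u & a u = Transmit p) (p \in packets a v).
Proof.
rewrite /packets mem_pmap; apply: (iffP mapP) => [[u _]|[u evu au]].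
  by case: (boolP (e v u)) => // evu; case au: (a u) => [q| |] // [->]; exists u.
by exists u; rewrite ?mem_enum // evu au.
Qed.

Lemma size_packets a v :
  size (packets a v) = #|[set u | e v u & transmits (a u)]|.
Proof.
rewrite /packets size_pmap cardsE cardE size_filter enumT.
apply: eq_count => u.
change (isSome (if e v u then if a u is Transmit p then Some p else None else None)
  = e v u && transmits (a u)).
by case: (e v u); case: (a u).
Qed.

Lemma some_packet_mem (s : seq P) :
  if some_packet (fun p => p \in s) is Some p then p \in s else s == [::].
Proof.
rewrite /some_packet; case: excluded_middle_informative => [h|h].
  exact: proj2_sig (constructive_indefinite_description _ h).
by case: s h => // x s []; exists x; rewrite inE eqxx.
Qed.

Lemma hear_msg txs p : hear txs = FMsg p -> p \in txs.
Proof.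
rewrite /hear; case: mdl.
- by move=> /=; have := some_packet_mem txs; case: some_packet => // q Hq [<-].
- by case: txs => [|q [|? ?]] // [->]; rewrite inE eqxx.
- by case: txs => [|q [|? ?]] // [->]; rewrite inE eqxx.
Qed.

Lemma fb_msg a v p :
  fb a v = FMsg p -> a v = Listen /\ exists2 u, e v u & a u = Transmit p.
Proof.
rewrite /fb; case: (a v) => // /hear_msg /packetsP; by split.
Qed.

End Programs.

(** * Compiling programs to distributed algorithms *)

Section Compile.
Variables (Msg : Type) (P : eqType).
Variables (rb len : nat -> nat -> nat).
Variable code : forall n D : nat, seq bool -> option Msg -> prog P (option Msg) (len n D).

(** The state is the rest of the program, packed with its length because [State] is one type for all
    slots. *)
Definition pstate := {B : nat & prog P (option Msg) B}.

Definition pact (st : pstate) : action P :=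
  let: existT B p := st in
  match B return prog P (option Msg) B -> action P with
  | 0 => fun=> Idle | B'.+1 => fun p => p.1 end p.

Definition pupd (st : pstate) (f : feedback P) : pstate :=
  let: existT B p := st in
  match B return prog P (option Msg) B -> pstate with
  | 0 => fun p => existT _ 0 p
  | B'.+1 => fun p => existT _ B' (p.2 (single_out f)) end p.

Definition pout (st : pstate) : option Msg :=
  let: existT B p := st in
  match B return prog P (option Msg) B -> option Msg with
  | 0 => id | B'.+1 => fun=> None end p.

Lemma pupd_perm st s1 s2 :
  perm_eq s1 s2 -> pupd st (FHeard s1) = pupd st (FHeard s2).
Proof. by case: st => [[|B] p] // s12; rewrite /pupd (single_out_perm s12). Qed.

Definition compile : algorithm Msg :=
  @Algorithm Msg pstate P rb len
    (fun n D bits i => existT _ (len n D) (code n D bits i)) pact pupd pout pupd_perm.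

Variables (mdl : radio_model) (n : nat) (D : nat) (e : rel 'I_n).
Variables (s : 'I_n) (m : Msg) (rnd : 'I_n -> seq bool).

Let stp (cur : 'I_n -> State compile) : 'I_n -> State compile :=
  fun v => upd (cur v) (feedback_of mdl e cur v).

Lemma exec_iter t :
  exec compile mdl D e s m rnd t = iter t stp (exec compile mdl D e s m rnd 0).
Proof. by elim: t => //= t ->. Qed.

Lemma incomingE (cur : 'I_n -> pstate) v :
  incoming (A := compile) e cur v = packets e (fun u => pact (cur u)) v.
Proof. by []. Qed.

Lemma stp_prog B (p : 'I_n -> prog P (option Msg) B.+1) :
  stp (fun v => existT _ B.+1 (p v)) =
  fun v => existT _ B ((p v).2 (fb mdl e (fun u => (p u).1) v)).
Proof.
apply: functional_extensionality => v.
rewrite /stp /= /pupd; congr (existT _ B ((p v).2 _)).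
rewrite /feedback_of /fb /= incomingE /=.
case: (p v).1 => //=; rewrite /channel /hear; case: mdl => //.
  by case: packets => [|? [|? ?]].
by case: packets => [|? [|? ?]].
Qed.

Lemma iter_stp B (p : 'I_n -> prog P (option Msg) B) :
  iter B stp (fun v => existT _ B (p v)) = fun v => existT _ 0 (run mdl e p v).
Proof. by elim: B p => [|B IH] p //; rewrite iterSr stp_prog IH. Qed.

Lemma compile_out v :
  out (exec compile mdl D e s m rnd (len n D) v) =
  run mdl e (fun v => code n D (rnd v) (if v == s then Some m else None)) v.
Proof. by rewrite exec_iter /= iter_stp. Qed.

Lemma iter_energy B (p : 'I_n -> prog P (option Msg) B) v c Q :
  spends c Q (p v) ->
  \sum_(t < B) (if act (iter t stp (fun v => existT _ B (p v)) v) is Idle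
                then 0 else 1) <= c.
Proof.
elim: B c p => [|B IH] c p /=; first by rewrite big_ord0.
case=> lc Hp; rewrite big_ord_recl /= -(subnKC lc) leq_add //.
apply: leq_trans (IH _ (fun v => (p v).2 (fb mdl e (fun u => (p u).1) v)) (Hp _)).
by apply: leq_sum => t _; rewrite -iterS iterSr stp_prog.
Qed.

Lemma compile_energy v c Q :
  spends c Q (code n D (rnd v) (if v == s then Some m else None)) ->
  energy compile mdl D e s m rnd (len n D) v <= c.
Proof.
move=> Hc; rewrite /energy.
under eq_bigr => t _ do rewrite exec_iter.
exact: (@iter_energy _ (fun v => code n D (rnd v) _) v _ Q Hc).
Qed.

End Compile.

(** * Averages over random bits *)

Section Expectation.
Local Open Scope ring_scope.
Variable n : nat.

(** The integrand takes plain sequences, so that bit strings can be cut by [take] and [drop] without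
    a change of type. *)
Definition Expect b (f : ('I_n -> seq bool) -> rat) : rat :=
  (\sum_(w : {ffun 'I_n -> b.-tuple bool}) f (fun v => tval (w v))) /
  #|{ffun 'I_n -> b.-tuple bool}|%:R.

Lemma card_bits b : #|{ffun 'I_n -> b.-tuple bool}| = ((2 ^ b) ^ n)%N.
Proof. by rewrite card_ffun card_tuple card_bool card_ord. Qed.

Lemma card_bits_neq0 b : #|{ffun 'I_n -> b.-tuple bool}|%:R != 0 :> rat.
Proof. by rewrite pnatr_eq0 card_bits -lt0n !expn_gt0. Qed.

Lemma eq_Expect b f g : (forall w, f w = g w) -> Expect b f = Expect b g.
Proof. by move=> fg; rewrite /Expect; under eq_bigr => w _ do rewrite fg. Qed.

Lemma le_Expect b f g : (forall w, f w <= g w) -> Expect b f <= Expect b g.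
Proof.
by move=> fg; rewrite /Expect ler_wpM2r ?invr_ge0 ?ler0n // ler_sum.
Qed.

Lemma Expect_cst b c : Expect b (fun=> c) = c.
Proof. by rewrite /Expect sumr_const -[c *+ _]mulr_natr mulfK // card_bits_neq0. Qed.

Lemma ExpectD b f g : Expect b (fun w => f w + g w) = Expect b f + Expect b g.
Proof. by rewrite /Expect big_split mulrDl. Qed.

Lemma ExpectZ b c f : Expect b (fun w => c * f w) = c * Expect b f.
Proof. by rewrite /Expect -mulr_sumr mulrA. Qed.

Lemma Expect_sum b (I : Type) (r : seq I) (Q : pred I) f :
  Expect b (fun w => \sum_(i <- r | Q i) f i w) =
  \sum_(i <- r | Q i) Expect b (f i).
Proof. by rewrite /Expect exchange_big mulr_suml. Qed.

(** Concatenation of bit strings is a bijection; this is the independence of fresh bits from those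
    used before. *)
Lemma Expect_split a b (g : ('I_n -> seq bool) -> ('I_n -> seq bool) -> rat) :
  Expect (a + b) (fun w => g (fun v => take a (w v)) (fun v => drop a (w v))) =
  Expect a (fun w1 => Expect b (fun w2 => g w1 w2)).
Proof.
have takeP (t : (a + b).-tuple bool) : size (take a t) == a.
  by rewrite size_takel // size_tuple leq_addr.
have dropP (t : (a + b).-tuple bool) : size (drop a t) == b.
  by rewrite size_drop size_tuple addKn.
pose h (x : {ffun 'I_n -> a.-tuple bool} * {ffun 'I_n -> b.-tuple bool}) :
  {ffun 'I_n -> (a + b).-tuple bool} := [ffun v => cat_tuple (x.1 v) (x.2 v)].
pose h' (w : {ffun 'I_n -> (a + b).-tuple bool}) :=
  ([ffun v => Tuple (takeP (w v))], [ffun v => Tuple (dropP (w v))]).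
rewrite /Expect -mulr_suml -mulrA -invfM -natrM; congr (_ / _%:R).
  rewrite (reindex h) /=; last first.
    exists h' => [[w1 w2] _|w _]; last first.
      by apply/ffunP => v; apply: val_inj; rewrite !ffunE /= cat_take_drop.
    congr (_, _); apply/ffunP => v; apply: val_inj; rewrite !ffunE /=.
      by rewrite take_size_cat // size_tuple.
    by rewrite drop_size_cat // size_tuple.
  rewrite pair_bigA; apply: eq_bigr => -[w1 w2] _ /=.
  congr (g _ _); apply: functional_extensionality => v; rewrite ffunE /=.
    by rewrite take_size_cat // size_tuple.
  by rewrite drop_size_cat // size_tuple.
by rewrite !card_bits expnD expnMn mulnC.
Qed.

Definition average b (h : seq bool -> rat) : rat :=
  (\sum_(t : b.-tuple bool) h t) / 2 ^+ b.

(** Independence of the vertices, by distributing the product over the sums. *)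
Lemma Expect_prod b (g : 'I_n -> seq bool -> rat) :
  Expect b (fun w => \prod_u g u (w u)) = \prod_u average b (g u).
Proof.
rewrite /Expect -(bigA_distr_bigA (fun u (t : b.-tuple bool) => g u t)) /average.
rewrite big_split /=; congr (_ * _).
by rewrite prodr_const card_ord exprVn card_bits !natrX.
Qed.

Lemma sum_tupleS b (h : seq bool -> rat) :
  \sum_(t : b.+1.-tuple bool) h t =
  \sum_(t : b.-tuple bool) (h (true :: t) + h (false :: t)).
Proof.
pose f (x : bool * b.-tuple bool) : b.+1.-tuple bool := cons_tuple x.1 x.2.
rewrite (reindex f) /=; last first.
  exists (fun t => (thead t, behead_tuple t)) => [[c t] _|t _].
    by congr (_, _); apply: val_inj.
  by apply: val_inj; rewrite /= [in RHS](tuple_eta t).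
rewrite -(pair_bigA _ (fun c (t : b.-tuple bool) => h (c :: t))) /=.
by rewrite big_bool /= -big_split.
Qed.

Lemma average_cst b c : average b (fun=> c) = c.
Proof.
rewrite /average sumr_const card_tuple card_bool -[c *+ _]mulr_natr natrX mulfK //.
by rewrite expf_neq0.
Qed.

Lemma averageB b h1 h2 :
  average b (fun t => h1 t - h2 t) = average b h1 - average b h2.
Proof. by rewrite /average sumrB mulrBl. Qed.

Lemma averageS b h :
  average b.+1 h =
  (average b (fun t => h (true :: t)) + average b (fun t => h (false :: t))) / 2.
Proof. by rewrite /average sum_tupleS big_split exprSr invfM mulrA /= !mulrDl. Qed.

Lemma average_level b i :
  (i < b)%N -> average b (fun t => (index true t == i)%:R) = (2^-1) ^+ i.+1.
Proof.
elim: b i => [|b IH] [|i] // ib; rewrite averageS /=.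
  by rewrite !average_cst addr0 mul1r expr1.
by rewrite average_cst add0r exprSr -(IH i ib).
Qed.

Lemma average_not_level b i : (i < b)%N ->
  average b (fun t => (index true t != i)%:R) = 1 - (2^-1) ^+ i.+1.
Proof.
move=> ib; transitivity (average b (fun=> 1) -
  average b (fun t => (index true t == i)%:R)).
  rewrite -averageB; congr (_ / _); apply: eq_bigr => t _.
  by case: eqP => _; rewrite ?subrr ?subr0.
by rewrite average_cst average_level.
Qed.

(** Rounds use fresh bits, so a potential that shrinks by the factor [g] in one round, from any
    state satisfying [inv], shrinks geometrically. *)
Lemma Expect_loop X O b (body : O -> ('I_n -> seq bool) -> ('I_n -> X) -> 'I_n -> X)
    (inv : ('I_n -> X) -> Prop) (phi : ('I_n -> X) -> rat) (g : rat) os x :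
  0 <= g -> (forall o w x, inv x -> inv (body o w x)) ->
  (forall o x, inv x -> Expect b (fun w => phi (body o w x)) <= g * phi x) ->
  inv x ->
  Expect (size os * b) (fun w => phi (nloop b body os w x)) <= g ^+ size os * phi x.
Proof.
move=> g0 Hinv Hphi; elim: os x => [|o os IH] x ix /=.
  by rewrite mul0n Expect_cst mul1r.
rewrite (@Expect_split b (size os * b)
  (fun w1 w2 => phi (nloop b body os w2 (body o w1 x)))).
apply: le_trans (le_Expect (g := fun w => g ^+ size os * phi (body o w x)) _ _) _.
  by move=> w1; apply: IH; apply: Hinv.
rewrite ExpectZ exprS [g * _]mulrC -mulrA ler_wpM2l ?exprn_ge0 //.
exact: Hphi.
Qed.

End Expectation.

(** * Clustering by labelings *)

Section Labelings.
Variables (n : nat) (e : rel 'I_n) (L : 'I_n -> nat).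

Definition good_labeling : Prop :=
  forall v, L v != 0 -> exists2 u, e v u & L v = (L u).+1.

(** The paths along which waves travel. A vertex may descend to several roots, so clusters may
    overlap. *)
Inductive descent : 'I_n -> 'I_n -> Prop :=
| descent_refl u : descent u u
| descent_step u u' v : e u u' -> L u = (L u').+1 -> descent u' v -> descent u v.

Lemma descent_le u v : descent u v -> L v <= L u.
Proof. by elim=> // {}u u' {}v _ -> _ /leqW. Qed.

Lemma descent_eq u v : descent u v -> L u <= L v -> u = v.
Proof.
case=> // {}u u' {}v _ -> /descent_le l1 l2.
by have := leq_trans l2 l1; rewrite ltnn.
Qed.

(** An ascending wave extends a descent at its lower end, whereas [descent_step] extends it at the
    upper end. *)
Lemma descent_last v u : descent v u ->
  v = u \/ exists z, [/\ descent v z, e z u & L z = (L u).+1].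
Proof.
elim=> [{}u|{}v u' {}u evu' Lv d [<-|[z [d1 ezu Lz]]]]; first by left.
  by right; exists v; split=> //; apply: descent_refl.
by right; exists z; split=> //; apply: descent_step d1.
Qed.

Definition roots : {set 'I_n} := [set v | L v == 0].

Lemma good_root v : good_labeling -> exists2 r, r \in roots & descent v r.
Proof.
move=> gL; move: {2}(L v) (erefl (L v)) => l; elim: l v => [|l IH] v Lv.
  by exists v; [rewrite inE Lv | apply: descent_refl].
have [|u evu] := gL v; rewrite Lv // => -[lu].
by have [r rr dr] := IH u (esym lu); exists r => //; apply: descent_step dr; rewrite ?Lv ?lu.
Qed.

Lemma good_values v j : good_labeling -> j <= L v -> exists u, L u = j.
Proof.
move=> gL; move: {2}(L v) (erefl (L v)) => l; elim: l v => [|l IH] v Lv; rewrite Lv.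
  by rewrite leqn0 => /eqP ->; exists v.
rewrite leq_eqVlt => /orP[/eqP ->|]; first by exists v.
have [|u evu] := gL v; rewrite Lv // => -[lu] jl.
by apply: (IH u); rewrite -?lu.
Qed.

(** All values up to [L v] occur, at distinct vertices. Hence serving [n] layers is enough for a
    wave. *)
Lemma good_lt v : good_labeling -> L v < n.
Proof.
move=> gL.
have /fin_all_exists[f Hf] (j : 'I_(L v).+1) : exists u, L u = j.
  by apply: good_values gL _; rewrite -ltnS.
have fI : injective f by move=> i j ij; apply: val_inj; rewrite /= -!Hf ij.
by have := leq_card f fI; rewrite !card_ord.
Qed.

Lemma connect_crossing (Q : 'I_n -> Prop) u v :
  connect e u v -> Q u -> ~ Q v -> exists a b, [/\ e a b, Q a & ~ Q b].
Proof.
case/connectP=> p; elim: p u => [|z p IH] u /= => [_ -> //|].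
case/andP=> euz pz lv Qu nQ.
have [Qz|nQz] := excluded_middle_informative (Q z); first exact: IH pz lv Qz nQ.
by exists u, z.
Qed.

(** The vertices that descend to [r] exclude any second root, so by connectivity some edge leaves
    this set. Its outer end descends to a root, which cannot be [r]. *)
Lemma neighbouring_root r : (forall u v, connect e u v) -> good_labeling ->
  1 < #|roots| -> r \in roots ->
  exists r', [/\ r' != r, r' \in roots &
    exists v z, [/\ e v z, descent v r & descent z r']].
Proof.
move=> conn gL r1 rr.
have [r2 r2r r2n] : exists2 r2, r2 \in roots & r2 != r.
  move: r1; rewrite (cardsD1 r) rr add1n ltnS card_gt0 => /set0Pn[z].
  by rewrite !inE => /andP[zr rz]; exists z; rewrite ?inE.
have nd : ~ descent r2 r.
  move=> /descent_eq E; move/eqP: r2n; apply; apply: E.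
  by move: r2r; rewrite inE => /eqP ->.
have [v [z [evz dv dz]]] :=
  connect_crossing (Q := fun v => descent v r) (conn r r2) (descent_refl r) nd.
have [r' r'r d'] := good_root z gL.
exists r'; split=> //; last by exists v, z.
by apply/eqP=> E; apply: dz; rewrite -E.
Qed.

End Labelings.

(** * The clustering protocol *)

Section Clustering.
Variable Msg : eqType.
Let pkt : eqType := (nat * option Msg)%type.
(** [sr] is an abstract local broadcast of [B] slots and [b] bits, so that the protocol is analysed
    once for all three models. *)
Variables (B b : nat) (sr : action pkt -> seq bool -> prog pkt (option pkt) B).

(* A node is a label together with the pair received in the current iteration:
   its next label and, in the last iteration, the message. *)
Definition node : Type := (nat * option pkt)%type.

(* [(s, r)]: labels satisfying [s] send, labels satisfying [r] receive. *)
Definition op : Type := (pred nat * pred nat)%type.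

(** A node with a pair can only send and a node without one can only listen, so the first pair
    received is final. *)
Definition role (o : op) (x : node) : action pkt :=
  if x.2 is Some p then (if o.1 x.1 then Transmit p else Idle)
  else (if o.2 x.1 then Listen else Idle).

Definition absorb (o : op) (x : node) (r : option pkt) : node :=
  if role o x is Listen then (x.1, omap (fun p : pkt => (p.1.+1, p.2)) r) else x.

Definition cast o bits x : prog pkt node B := mapp (absorb o x) (sr (role o x) bits).

Definition casts os := loop b cast os.

Definition down_op i : op := (fun l => l == i, fun l => l == i.+1).
Definition up_op i : op := (fun l => l == i.+1, fun l => l == i).
Definition all_op : op := (fun=> true, fun=> true).
Definition downs i k : seq op := [seq down_op j | j <- iota i k].
Fixpoint ups k : seq op := if k is k'.+1 then up_op k' :: ups k' else [::].
Definition gather k : seq op := downs 0 k ++ all_op :: ups k.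

(** The default 0 turns a vertex that received nothing into a root. *)
Definition next_label (x : node) : nat := if x.2 is Some p then p.1 else 0.

Definition seed (src : option Msg) (last : bool) (bits : seq bool) (x : node) : node :=
  (next_label x,
   if last then omap (fun m => (0, Some m)) src
   else if (next_label x == 0) && head false bits then Some (0, None) else None).

Definition reseed (x : node) : node :=
  if (x.1 == 0) && ~~ isSome x.2 then (0, Some (0, None)) else x.

Definition iteration n src last bits x :
    prog pkt node (size (gather n) * B + size (downs 0 n) * B) :=
  bind (casts (gather n) (take (size (gather n) * b) (drop 1 bits))
              (seed src last (take 1 bits) x))
       (fun y => casts (downs 0 n) (drop (size (gather n) * b) (drop 1 bits)) (reseed y)).

Definition iteration_bits n := 1 + (size (gather n) * b + size (downs 0 n) * b).

Definition kinds K := nseq K false ++ [:: true].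

Definition message (x : node) : option Msg := if x.2 is Some p then p.2 else None.

Definition broadcast n K bits src :
    prog pkt (option Msg) (size (kinds K) * (size (gather n) * B + size (downs 0 n) * B)) :=
  mapp message (loop (iteration_bits n) (iteration n src) (kinds K) bits (0, Some (0, None))).

(** * Energy of the protocol *)

Section Energy.
Variable E : nat.
Hypothesis sr_energy : forall a bits,
  spends (if a is Idle then 0 else E) (fun=> True) (sr a bits).

Lemma spends_cast l o bits x : x.1 = l ->
  spends (E * (o.1 l || o.2 l)) (fun y => y.1 = l) (cast o bits x).
Proof.
move=> xl; apply: spends_mapp.
apply: spends_weaken (sr_energy (role o x) bits); last first.
  by move=> r _; rewrite /absorb; case: role.
rewrite /role xl; case: x.2 => [p|]; case: (o.1 l); case: (o.2 l) => //=;
  by rewrite ?muln1 ?muln0.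
Qed.

Lemma spends_casts os bits x :
  spends (E * count (fun o : op => o.1 x.1 || o.2 x.1) os) (fun y => y.1 = x.1)
    (casts os bits x).
Proof.
have := @spends_loop _ _ _ b _ cast (fun y => y.1 = x.1)
  (fun o : op => E * (o.1 x.1 || o.2 x.1)) os bits x
  (fun o bits y yx => spends_cast o bits yx) erefl.
apply: spends_weaken => //; rewrite -big_distrr /= leq_mul2l -sum1_count.
by rewrite [X in _ <= X]big_mkcond; apply/orP; right; apply: leq_sum => i _; case: ifP.
Qed.

(** Label [l] takes part only when layer [l] or layer [l.-1] is served. *)
Lemma count_downs l k :
  count (fun o : op => o.1 l || o.2 l) (downs 0 k) <= 2.
Proof.
rewrite count_map.
apply: (@leq_trans (count (predU (pred1 l) (pred1 l.-1)) (iota 0 k))).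
  apply: sub_count => j /=; rewrite eq_sym => /orP[->//|/eqP ->].
  by rewrite eqxx orbT.
rewrite -(leq_add2r (count (predI (pred1 l) (pred1 l.-1)) (iota 0 k))) count_predUI.
rewrite !count_uniq_mem ?iota_uniq //.
by apply: leq_trans (leq_addr _ _); case: (_ \in _); case: (_ \in _).
Qed.

Lemma count_ups l k : count (fun o : op => o.1 l || o.2 l) (ups k) <= (l < k) + (l <= k).
Proof.
elim: k => [|k IH] //=.
apply: leq_trans (leq_add (leqnn _) IH) _.
clear IH; lia.
Qed.

Lemma spends_iteration n src last bits x :
  spends (E * 7) (fun=> True) (iteration n src last bits x).
Proof.
(* Five for [gather] (two down, one across, two up) and two for the last descent. *)
rewrite (_ : 7 = 5 + 2) // mulnDr; apply: (spends_bind (Q1 := fun=> True)) => [|y _].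
  apply: spends_weaken (spends_casts _ _ _) => //.
  rewrite leq_mul2l count_cat /=; apply/orP; right.
  have := count_downs (next_label x) n; have := count_ups (next_label x) n.
  lia.
apply: spends_weaken (spends_casts _ _ _) => //.
by rewrite leq_mul2l count_downs orbT.
Qed.

Lemma spends_broadcast n K bits src :
  spends (K.+1 * (E * 7)) (fun=> True) (broadcast n K bits src).
Proof.
apply: spends_mapp.
have := @spends_loop _ _ _ (iteration_bits n) _ (iteration n src) (fun=> True)
  (fun=> E * 7) (kinds K) bits (0, Some (0, None))
  (fun o bits y _ => spends_iteration n src o bits y) I.
apply: spends_weaken => //.
by rewrite big_const_seq count_predT iter_addn_0 mulnC /kinds size_cat size_nseq addn1.
Qed.

End Energy.

(** * Propagation of the waves *)

Section Network.
Variables (mdl : radio_model) (n : nat) (e : rel 'I_n).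
Implicit Types (x : 'I_n -> node) (w : 'I_n -> seq bool).

Definition sr_run (a : 'I_n -> action pkt) w : 'I_n -> option pkt :=
  run mdl e (fun v => sr (a v) (w v)).

Hypothesis sr_sound : forall a w v p, a v = Listen -> sr_run a w v = Some p ->
  exists2 u, e v u & a u = Transmit p.

Definition cast_run o w x : 'I_n -> node :=
  fun v => absorb o (x v) (sr_run (fun u => role o (x u)) w v).

Definition casts_run := nloop b cast_run.

Lemma casts_run_cons o os w x : casts_run (o :: os) w x =
  casts_run os (fun v => drop b (w v)) (cast_run o (fun v => take b (w v)) x).
Proof. by []. Qed.

Lemma run_casts os w x :
  run mdl e (fun v => casts os (w v) (x v)) = casts_run os w x.
Proof.
rewrite (run_loop mdl e b (fun=> cast)) /casts_run.
congr nloop; apply: functional_extensionality => o.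
apply: functional_extensionality => w'; apply: functional_extensionality => x'.
by rewrite /cast run_mapp.
Qed.

(** The only bad event of a cast. Outside it, propagation is a matter of labels and edges, free of
    probability. *)
Definition cast_fails o w x : bool :=
  [exists v, [&& listens (role o (x v)),
    [exists u, e v u && transmits (role o (x u))] &
    ~~ isSome (sr_run (fun u => role o (x u)) w v)]].

Fixpoint casts_fail os w x : bool :=
  if os is o :: os' then
    cast_fails o (fun v => take b (w v)) x ||
    casts_fail os' (fun v => drop b (w v)) (cast_run o (fun v => take b (w v)) x)
  else false.

Lemma casts_run_cat os1 os2 w x :
  casts_run (os1 ++ os2) w x =
  casts_run os2 (fun v => drop (size os1 * b) (w v)) (casts_run os1 w x).
Proof.
elim: os1 w x => [|o os IH] w x /=.
  by congr (casts_run os2 _ x); apply: functional_extensionality => v; rewrite drop0.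
rewrite !casts_run_cons IH; congr (casts_run os2 _ _).
by apply: functional_extensionality => v; rewrite drop_drop mulSn addnC.
Qed.

Lemma casts_fail_cat os1 os2 w x :
  casts_fail (os1 ++ os2) w x = casts_fail os1 w x ||
  casts_fail os2 (fun v => drop (size os1 * b) (w v)) (casts_run os1 w x).
Proof.
elim: os1 w x => [|o os IH] w x /=.
  by congr (casts_fail os2 _ x); apply: functional_extensionality => v; rewrite drop0.
rewrite casts_run_cons IH -orbA; congr (_ || (_ || casts_fail os2 _ _)).
by apply: functional_extensionality => v; rewrite drop_drop mulSn addnC.
Qed.

Lemma cast_run_cases o w x v : cast_run o w x v = x v \/
  (x v).2 = None /\ exists2 u, e v u &
    exists2 p, (x u).2 = Some p & cast_run o w x v = ((x v).1, Some (p.1.+1, p.2)).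
Proof.
rewrite /cast_run /absorb; case rv: (role o (x v)) => [q||]; try by left.
have xv : (x v).2 = None by move: rv; rewrite /role; case: (x v).2 => // p; case: ifP.
case E: (sr_run _ _ v) => [p|] /=; last by left; rewrite -xv; case: (x v).
right; split=> //; have [u evu ru] := sr_sound rv E.
exists u => //; exists p => //; move: ru; rewrite /role.
by case: (x u).2 => [q|]; case: ifP => // _ [->].
Qed.

Lemma cast_run_label o w x v : (cast_run o w x v).1 = (x v).1.
Proof. by case: (cast_run_cases o w x v) => [->|[_ [u _ [p _ ->]]]]. Qed.

Lemma cast_run_fixed o w x v : isSome (x v).2 -> cast_run o w x v = x v.
Proof. by case: (cast_run_cases o w x v) => // -[->]. Qed.

Lemma casts_run_label os w x v : (casts_run os w x v).1 = (x v).1.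
Proof.
by elim: os w x => [|o os IH] w x //; rewrite casts_run_cons IH cast_run_label.
Qed.

Lemma casts_run_fixed os w x v : isSome (x v).2 -> casts_run os w x v = x v.
Proof.
elim: os w x => [|o os IH] w x xv //; rewrite casts_run_cons IH cast_run_fixed //.
Qed.

(* Every pair held was produced at a neighbour, or by seeding. *)
Definition traced x : Prop := forall v p, (x v).2 = Some p -> p.1 != 0 ->
  exists2 u, e v u & exists2 q, (x u).2 = Some q & p.1 = q.1.+1.

Lemma casts_run_traced os w x : traced x -> traced (casts_run os w x).
Proof.
elim: os w x => [|o os IH] w x // tx; rewrite casts_run_cons; apply: IH => v p.
set w' := fun v => _.
case: (cast_run_cases o w' x v) => [->|[_ [u evu [q xu ->]]]].
  move=> xv p0; have [u evu [q xu pq]] := tx v p xv p0.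
  by exists u => //; exists q => //; rewrite cast_run_fixed ?xu.
by move=> [<-] _; exists u => //; exists q => //; rewrite cast_run_fixed ?xu.
Qed.

(** Reception adds one to the hop count, so a pair with hop count 0 was there from the start. *)
Lemma casts_run_zero os w x v y :
  (casts_run os w x v).2 = Some (0, y) -> (x v).2 = Some (0, y).
Proof.
elim: os w x => [|o os IH] w x //; rewrite casts_run_cons => /IH.
by case: (cast_run_cases o (fun v => take b (w v)) x v) => [->|[_ [u evu [q xu ->]]]].
Qed.

Lemma casts_run_message os w x y : (forall v p, (x v).2 = Some p -> p.2 = y) ->
  forall v p, (casts_run os w x v).2 = Some p -> p.2 = y.
Proof.
elim: os w x => [|o os IH] w x // xy; rewrite casts_run_cons; apply: IH => v p.
set w' := fun v => _.
case: (cast_run_cases o w' x v) => [->|[_ [u evu [q xu ->]]]]; first exact: xy.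
by move=> [<-]; apply: xy xu.
Qed.

Lemma cast_spreads o w x u v : ~~ cast_fails o w x -> o.2 (x v).1 -> e v u ->
  isSome (x u).2 -> o.1 (x u).1 -> isSome (cast_run o w x v).2.
Proof.
move=> nf ov evu; case xu: (x u).2 => [p|] // _ ou.
case xv: (x v).2 => [q|]; first by rewrite cast_run_fixed xv.
have rv : role o (x v) = Listen by rewrite /role xv ov.
have sender : [exists u, e v u && transmits (role o (x u))].
  by apply/existsP; exists u; rewrite evu /role xu ou.
move: nf; rewrite negb_exists => /forallP/(_ v).
by rewrite sender rv /cast_run /absorb rv /= negbK; case: sr_run.
Qed.

(** Cast [i] informs layer [i.+1]: the next vertex on the descent to [v] has label [i] and is
    informed already. *)
Lemma downs_spread L i k w x v :
  (forall u, (x u).1 = L u) -> ~~ casts_fail (downs i k) w x ->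
  isSome (x v).2 ->
  (forall u, descent e L u v -> L u <= i -> isSome (x u).2) ->
  forall u, descent e L u v -> L u <= i + k ->
  isSome (casts_run (downs i k) w x u).2.
Proof.
elim: k i w x => [|k IH] i w x xL /=; first by rewrite addn0.
rewrite negb_or casts_run_cons -/(downs i.+1 k) addnS -addSn => /andP[nf nfs] xv xi.
apply: IH => // [u||u duv]; first by rewrite cast_run_label.
  by rewrite cast_run_fixed.
rewrite leq_eqVlt ltnS => /orP[/eqP Lu|/(xi u duv) su]; last by rewrite cast_run_fixed.
case: duv Lu xv => [{}u|{}u u' {}v euu' Luu' d] Lu xv in xi *.
  by rewrite cast_run_fixed.
have Lu' : L u' = i by apply/eqP; rewrite -eqSS -Luu' Lu.
by apply: (cast_spreads nf _ euu'); rewrite /= ?xL ?Lu ?Lu' //; apply: xi; rewrite ?Lu'.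
Qed.

(** The layers are served in decreasing order, so [u] hears from the vertex just before it on the
    descent from [v]. *)
Lemma ups_spread L k w x v :
  (forall u, (x u).1 = L u) -> ~~ casts_fail (ups k) w x ->
  symmetric e -> isSome (x v).2 ->
  (forall u, descent e L v u -> k <= L u -> isSome (x u).2) ->
  forall u, descent e L v u -> isSome (casts_run (ups k) w x u).2.
Proof.
move=> xL nf sym; elim: k w x xL nf => [|k IH] w x xL /=.
  by move=> _ xv xi u d; apply: xi.
rewrite negb_or casts_run_cons => /andP[nf nfs] xv xi.
apply: IH => // [u||u dvu]; first by rewrite cast_run_label.
  by rewrite cast_run_fixed.
rewrite leq_eqVlt => /orP[/eqP Lu|/(xi u dvu) su]; last by rewrite cast_run_fixed.
case: (descent_last dvu) => [<-|[z [dvz ezu Lz]]]; first by rewrite cast_run_fixed.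
rewrite sym in ezu.
by apply: (cast_spreads nf _ ezu); rewrite /= ?xL ?Lz -?Lu //; apply: xi; rewrite ?Lz -?Lu.
Qed.

Hypotheses (e_sym : symmetric e) (e_conn : forall u v, connect e u v).
Variable src : 'I_n -> option Msg.

Definition good x : Prop := good_labeling e (fun v => next_label (x v)).

Definition seeded last w x : 'I_n -> node := fun v => seed (src v) last (w v) (x v).
Definition gathered last w1 w2 x := casts_run (gather n) w2 (seeded last w1 x).
Definition reseeded last w1 w2 x : 'I_n -> node :=
  fun v => reseed (gathered last w1 w2 x v).
Definition iterated last w1 w2 w3 x :=
  casts_run (downs 0 n) w3 (reseeded last w1 w2 x).
Definition iterated_fails last w1 w2 w3 x :=
  casts_fail (gather n) w2 (seeded last w1 x) ||
  casts_fail (downs 0 n) w3 (reseeded last w1 w2 x).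

Let G := size (gather n) * b.
Let part1 w v := take 1 (w v).
Let part2 w v := take G (drop 1 (w v)).
Let part3 w v := drop G (drop 1 (w v)).

Lemma run_iteration last w x :
  run mdl e (fun v => iteration n (src v) last (w v) (x v)) =
  iterated last (part1 w) (part2 w) (part3 w) x.
Proof. by rewrite /iteration run_bind !run_casts. Qed.

(** True even when casts fail: a positive hop count was copied from a neighbour that keeps its pair,
    and a vertex left with nothing gets label 0. A failure thus never destroys the invariant. *)
Lemma iterated_good last w1 w2 w3 x : good (iterated last w1 w2 w3 x).
Proof.
have t1 : traced (gathered last w1 w2 x).
  apply: casts_run_traced => v p; rewrite /seeded /seed /=.
  case: last; first by case: (src v) => // m [<-].
  by case: ifP => // _ [<-].
have t2 : traced (reseeded last w1 w2 x).
  move=> v p; rewrite /reseeded {1}/reseed; case: ifP => [_ [<-] //|_] xv p0.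
  have [u evu [q xu pq]] := t1 v p xv p0.
  by exists u => //; exists q => //; rewrite /reseed xu andbF.
move=> v; have t3 := @casts_run_traced (downs 0 n) w3 _ t2.
rewrite /next_label; case xv: (iterated _ _ _ _ _ v).2 => [p|] // p0.
by have [u evu [q xu pq]] := t3 v p xv p0; exists u => //; rewrite xu.
Qed.

Section GoodIteration.
Variables (last : bool) (w1 w2 w3 : 'I_n -> seq bool) (x : 'I_n -> node).
Hypotheses (gx : good x) (ok : ~~ iterated_fails last w1 w2 w3 x).
Let L v := next_label (x v).

Let gather_ok : ~~ casts_fail (gather n) w2 (seeded last w1 x).
Proof. by move: ok; rewrite negb_or => /andP[]. Qed.

Let from_root r u : r \in roots L -> descent e L u r -> L u <= 0 -> u = r.
Proof. by move=> rr d Lu; apply: descent_eq d _; rewrite (leq_trans Lu). Qed.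

Let ups_n w y v r : (forall u, (y u).1 = L u) -> ~~ casts_fail (ups n) w y ->
  isSome (y v).2 -> descent e L v r -> isSome (casts_run (ups n) w y r).2.
Proof.
move=> yL nf yv d; apply: (ups_spread yL) d => // u _.
by rewrite leqNgt (good_lt u gx).
Qed.

(** For the last iteration, where the wave starts at the source, which may have any label. *)
Lemma gathered_up v r : isSome (seeded last w1 x v).2 -> descent e L v r ->
  isSome (gathered last w1 w2 x r).2.
Proof.
move=> sv d; move: gather_ok; rewrite casts_fail_cat /= !negb_or => /and3P[_ _ nf].
rewrite /gathered casts_run_cat casts_run_cons; apply: ups_n nf _ d => [u|].
  by rewrite cast_run_label casts_run_label.
by rewrite cast_run_fixed casts_run_fixed.
Qed.

(** The wave runs from [r'] down to [z], across the edge to [v], and up to [r]. *)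
Lemma gathered_across r' z v r : isSome (seeded last w1 x r').2 ->
  r' \in roots L -> descent e L z r' -> e v z -> descent e L v r ->
  isSome (gathered last w1 w2 x r).2.
Proof.
move=> sr' rr' dz evz dv; move: gather_ok.
rewrite casts_fail_cat /= !negb_or => /and3P[nf1 nf2 nf3].
rewrite /gathered casts_run_cat casts_run_cons; apply: ups_n nf3 _ dv => [u|].
  by rewrite cast_run_label casts_run_label.
apply: (cast_spreads nf2 _ evz) => //.
apply: (downs_spread (L := L)) dz _ => // [u d Lu|]; last first.
  by rewrite add0n ltnW // (good_lt z gx).
by rewrite (from_root rr' d Lu).
Qed.

(** After reseeding every root holds a pair, and every vertex descends to some root. *)
Lemma iterated_set v : isSome (iterated last w1 w2 w3 x v).2.
Proof.
have [r rr d] := good_root v gx.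
have lab u : (reseeded last w1 w2 x u).1 = L u.
  rewrite -[RHS](casts_run_label (gather n) w2 (seeded last w1 x)) /reseeded /reseed.
  by case: ifP => // /andP[/eqP -> _].
have rset : isSome (reseeded last w1 w2 x r).2.
  have gr : (gathered last w1 w2 x r).1 = L r := casts_run_label _ _ _ _.
  have Lr : L r = 0 by move: rr; rewrite inE => /eqP.
  by rewrite /reseeded /reseed gr Lr /=; case: ifP => // /negbFE.
apply: (downs_spread lab) d _ => // [|u d Lu|].
- by move: ok; rewrite negb_or => /andP[].
- by rewrite (from_root rr d Lu).
- by rewrite add0n ltnW // (good_lt v gx).
Qed.

(** Hop count 0 stems from a seed or a reseed, and both are reserved to old roots; hence no new
    roots arise. *)
Lemma iterated_root v : ~~ last -> next_label (iterated last w1 w2 w3 x v) == 0 ->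
  v \in roots L /\ (head false (w1 v) \/ (gathered last w1 w2 x v).2 = None).
Proof.
move=> /negbTE nlast; have := iterated_set v.
rewrite /next_label; case xv: (iterated _ _ _ _ _ v).2 => [[l y]|] //= _ /eqP l0.
rewrite l0 in xv; move: (casts_run_zero xv); rewrite /reseeded /reseed.
case: ifP => [/andP[l1 l2] _|_ /casts_run_zero].
  split; first by move: l1; rewrite casts_run_label inE.
  by right; case: (gathered _ _ _ _ v).2 l2.
rewrite /seeded /seed nlast /=; case: ifP => // /andP[Lv c] _.
by rewrite inE; split=> //; left.
Qed.

End GoodIteration.

(** The wave of the source climbs to the only root, so no vertex reseeds and every pair in
    circulation carries [Some m]. *)
Lemma iterated_message w1 w2 w3 x s m :
  good x -> ~~ iterated_fails true w1 w2 w3 x ->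
  #|roots (fun v => next_label (x v))| <= 1 ->
  (forall v, src v = if v == s then Some m else None) ->
  forall v, message (iterated true w1 w2 w3 x v) = Some m.
Proof.
move=> gx ok r1 srcE v.
have ss : isSome (seeded true w1 x s).2 by rewrite /seeded /seed /= srcE eqxx.
have [r rr d] := good_root s gx.
have gr := gathered_up gx ok ss d.
have resE : reseeded true w1 w2 x = gathered true w1 w2 x.
  apply: functional_extensionality => u; rewrite /reseeded /reseed.
  case: ifP => // /andP[]; rewrite casts_run_label => Lu.
  have ur : u \in roots (fun v => next_label (x v)) by rewrite inE.
  by rewrite (card_le1_eqP r1 _ _ rr ur) gr.
have := iterated_set gx ok v.
rewrite /message; case xv: (iterated _ _ _ _ _ v).2 => [p|] // _.
apply: (casts_run_message _ xv) => {xv p} u p; rewrite resE.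
apply: casts_run_message => {u p} u p.
by rewrite /seeded /seed /= srcE; case: eqP => // _ [<-].
Qed.

(** * Failure probability of the protocol *)

Local Open Scope ring_scope.
Variable eps : rat.
Hypothesis eps_ge0 : 0 <= eps.
Hypothesis sr_fail : forall a v, a v = Listen ->
  [exists u, e v u && transmits (a u)] ->
  Expect b (fun w => (~~ isSome (sr_run a w v))%:R) <= eps.

Let delta : rat := n%:R * eps.

(** Union bound over the listeners with a sending neighbour. *)
Lemma Expect_cast_fails o x : Expect b (fun w => (cast_fails o w x)%:R) <= delta.
Proof.
pose a u := role o (x u).
pose c v := listens (a v) && [exists u, e v u && transmits (a u)].
apply: le_trans (le_Expect b (g := fun w =>
  \sum_(v | c v) (~~ isSome (sr_run a w v))%:R) _) _ => [w|].
  case: (boolP (cast_fails o w x)) => [/existsP[v /and3P[v1 v2 v3]]|_]; last first.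
    by apply: sumr_ge0 => v _; apply: ler0n.
  rewrite (bigD1 v) /=; last by rewrite /c v1.
  by rewrite v3 lerDl sumr_ge0 // => u _; apply: ler0n.
rewrite Expect_sum; apply: (@le_trans _ _ (\sum_(v : 'I_n) eps)).
  rewrite big_mkcond; apply: ler_sum => v _; case: ifP => // /andP[lv sv].
  by apply: sr_fail sv; case: (a v) lv.
by rewrite sumr_const card_ord -mulr_natl.
Qed.

Lemma ler_orb (p q : bool) : (p || q)%:R <= p%:R + q%:R :> rat.
Proof. by case: p; case: q; rewrite ?addr0 ?add0r // lerDl ler01. Qed.

Lemma Expect_casts_fail os x :
  Expect (size os * b) (fun w => (casts_fail os w x)%:R) <= (size os)%:R * delta.
Proof.
elim: os x => [|o os IH] x /=; first by rewrite mul0n Expect_cst mul0r.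
rewrite (@Expect_split _ b (size os * b) (fun w1 w2 =>
  (cast_fails o w1 x || casts_fail os w2 (cast_run o w1 x))%:R)).
apply: le_trans (le_Expect b (g := fun w =>
  (cast_fails o w x)%:R + (size os)%:R * delta) _) _ => [w|].
  apply: le_trans (le_Expect _ (fun w2 => ler_orb _ _)) _.
  by rewrite ExpectD Expect_cst lerD2l; apply: IH.
by rewrite ExpectD Expect_cst mulrSr mulrDl mul1r addrC lerD2l Expect_cast_fails.
Qed.

Let M : nat := size (gather n) + size (downs 0 n).

Lemma Expect_iterated_fails last w1 x :
  Expect (G + size (downs 0 n) * b) (fun w => (iterated_fails last w1
    (fun v => take G (w v)) (fun v => drop G (w v)) x)%:R) <= M%:R * delta.
Proof.
rewrite (@Expect_split _ G _ (fun w2 w3 => (iterated_fails last w1 w2 w3 x)%:R)).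
apply: le_trans (le_Expect G (g := fun w => (casts_fail (gather n) w (seeded last w1 x))%:R
  + (size (downs 0 n))%:R * delta) _) _ => [w|].
  apply: le_trans (le_Expect _ (fun w2 => ler_orb _ _)) _.
  by rewrite ExpectD Expect_cst lerD2l; apply: Expect_casts_fail.
by rewrite ExpectD Expect_cst natrD mulrDl lerD2r; apply: Expect_casts_fail.
Qed.

(** The last root never disappears, so the bare number of roots would not contract towards 0; with
    the value 0 at a single root it does. *)
Definition excess x : rat :=
  let k := #|roots (fun v => next_label (x v))| in if (k <= 1)%N then 0 else k%:R.

Lemma excess_le x : excess x <= n%:R.
Proof.
rewrite /excess; case: ifP => _; first exact: ler0n.
by rewrite ler_nat -[leqRHS]card_ord max_card.
Qed.

Lemma excess_ge0 x : 0 <= excess x.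
Proof. by rewrite /excess; case: ifP => _ //; apply: ler0n. Qed.

(* A root survives only if its coin is heads or the coin of its chosen mate is
   tails. *)
Lemma excess_iterated x : good x ->
  let R := roots (fun v => next_label (x v)) in
  exists mate : 'I_n -> 'I_n, ((1 < #|R|)%N -> forall r, r \in R -> mate r != r) /\
  forall w1 w2 w3, excess (iterated false w1 w2 w3 x) <=
    n%:R * (iterated_fails false w1 w2 w3 x)%:R +
    (if (#|R| <= 1)%N then 0 else
      \sum_(r in R) (head false (w1 r) || ~~ head false (w1 (mate r)))%:R).
Proof.
move=> gx R.
pose adj r r' := exists v z,
  [/\ e v z, descent e (fun v => next_label (x v)) v r &
   descent e (fun v => next_label (x v)) z r'].
have /fin_all_exists[mate Hm] r : exists r', (1 < #|R|)%N -> r \in R ->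
    [/\ r' != r, r' \in R & adj r r'].
  case: (boolP ((1 < #|R|)%N && (r \in R))) => [/andP[R1 rR]|nR].
    by have [r' Hr'] := neighbouring_root e_conn gx R1 rR; exists r'.
  by exists r => R1 rR; rewrite R1 rR in nR.
exists mate; split=> [R1 r rR|w1 w2 w3]; first by case: (Hm r R1 rR).
case: (boolP (iterated_fails _ _ _ _ _)) => [_|ok].
  (* After a failure only the trivial bound [n] is left. *)
  rewrite mulr1; apply: le_trans (excess_le _) _.
  by rewrite lerDl; case: ifP => // _; apply: sumr_ge0 => r _; apply: ler0n.
rewrite mulr0 add0r.
set R' := roots (fun v => next_label (iterated false w1 w2 w3 x v)).
have R'R : R' \subset R.
  apply/subsetP => v; rewrite inE => v0.
  by have [] := iterated_root gx ok isT v0.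
rewrite /excess -/R'; case: ifP => R1'.
  by case: ifP => // _; apply: sumr_ge0 => r _; apply: ler0n.
case: ifP => R1; first by rewrite (leq_trans (subset_leq_card R'R) R1) in R1'.
rewrite -sumr_const [leLHS]big_mkcond [leRHS]big_mkcond /=.
apply: ler_sum => r _; case: ifP => [rR'|_]; last by case: ifP => // _; apply: ler0n.
rewrite (subsetP R'R) //.
move: rR'; rewrite inE => r0.
have [rR [-> //|gr]] := iterated_root gx ok isT r0.
have {}R1 : (1 < #|R|)%N by rewrite ltnNge R1.
have [_ mR [v [z [evz dv dz]]]] := Hm r R1 rR.
case: (boolP (head false (w1 (mate r)))) => [hm|_]; last by rewrite orbT.
have sm : isSome (seeded false w1 x (mate r)).2.
  by move: mR; rewrite /seeded /seed /= inE hm => ->.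
(* A mate showing heads would have reached [r], contrary to [gr]. *)
by have := gathered_across gx ok sm mR dz evz dv; rewrite gr.
Qed.

Lemma average_heads : average 1 (fun t => (head false t)%:R) = 1 / 2.
Proof. by rewrite averageS !average_cst addr0. Qed.

Lemma average_tails : average 1 (fun t => (~~ head false t)%:R) = 1 / 2.
Proof. by rewrite averageS !average_cst add0r. Qed.

(** The complement, tails at [r] and heads at [r'], has probability 1/4, as coins of distinct
    vertices are independent. *)
Lemma Expect_survives (r r' : 'I_n) : r' != r ->
  Expect 1 (fun w => (head false (w r) || ~~ head false (w r'))%:R) = 3 / 4.
Proof.
move=> rr'.
pose g u (t : seq bool) : rat := if u == r then (~~ head false t)%:R
  else if u == r' then (head false t)%:R else 1.
rewrite (@eq_Expect _ 1 _ (fun w => 1 + (-1) * \prod_u g u (w u))).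
  rewrite ExpectD Expect_cst ExpectZ Expect_prod (bigD1 r) //= (bigD1 r') //=.
  rewrite big1 => [|u /andP[/negbTE ur /negbTE ur']]; last first.
    by rewrite /g ur ur' average_cst.
  rewrite /g eqxx eqxx (negbTE rr') average_tails average_heads; lra.
move=> w; rewrite (bigD1 r) //= (bigD1 r') //= big1 => [|u /andP[/negbTE ur /negbTE ur']].
  rewrite /g eqxx eqxx (negbTE rr').
  by case: (head _ (w r)); case: (head _ (w r')) => /=; lra.
by rewrite /g ur ur'.
Qed.

Definition iterated_run last w x := iterated last (part1 w) (part2 w) (part3 w) x.

Lemma Expect_excess x : good x ->
  Expect (iteration_bits n) (fun w => excess (iterated_run false w x)) <=
  3 / 4 * excess x + n%:R * (M%:R * delta).
Proof.
move=> gx; have [mate [Hm Hle]] := excess_iterated gx.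
set R := roots _ in Hm Hle.
pose S (w1 : 'I_n -> seq bool) : rat := if (#|R| <= 1)%N then 0 else
  \sum_(r in R) (head false (w1 r) || ~~ head false (w1 (mate r)))%:R.
rewrite /iteration_bits (@Expect_split _ 1 _ (fun w1 w => excess (iterated false w1
  (fun v => take G (w v)) (fun v => drop G (w v)) x))).
apply: le_trans (le_Expect 1 (g := fun w1 => n%:R * (M%:R * delta) + S w1) _) _ => [w1|].
  apply: le_trans (le_Expect _ (fun w => Hle w1 _ _)) _.
  rewrite ExpectD Expect_cst lerD2r ExpectZ ler_wpM2l ?ler0n //.
  exact: Expect_iterated_fails.
rewrite ExpectD Expect_cst addrC lerD2r /S /excess -/R.
case: ifP => [_|/negbT]; first by rewrite Expect_cst mulr0.
rewrite -ltnNge => R1; rewrite Expect_sum.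
under eq_bigr => r rR do rewrite (Expect_survives (Hm R1 r rR)).
by rewrite sumr_const mulr_natr.
Qed.

Lemma three_quarters K : 0 <= (3 / 4 : rat) ^+ K <= 1.
Proof.
have h0 : 0 <= (3 / 4 : rat) by lra.
have h1 : (3 / 4 : rat) <= 1 by lra.
by rewrite exprn_ge0 ?exprn_ile1.
Qed.

(** Without a failed cast the message is missed only if there are several roots, and then [excess x]
    is at least 1. *)
Lemma Expect_last s m x :
  (forall v, src v = if v == s then Some m else None) -> good x ->
  Expect (iteration_bits n) (fun w =>
    (~~ [forall v, message (iterated_run true w x v) == Some m])%:R) <=
  excess x + M%:R * delta.
Proof.
move=> srcE gx.
rewrite /iteration_bits (@Expect_split _ 1 _ (fun w1 w => (~~ [forall v, message
  (iterated true w1 (fun v => take G (w v)) (fun v => drop G (w v)) x v) == Some m])%:R)).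
apply: le_trans (le_Expect 1 (g := fun=> excess x + M%:R * delta) _) _ => [w1|].
  apply: le_trans (le_Expect _ (g := fun w => excess x + (iterated_fails true w1
    (fun v => take G (w v)) (fun v => drop G (w v)) x)%:R) _) _ => [w|].
    case: (boolP (iterated_fails _ _ _ _ _)) => [_|ok].
      by apply: (@le_trans _ _ 1); rewrite ?lerDr ?excess_ge0 //; case: forallP.
    rewrite addr0 {1}/excess; case: ifP => R1.
      by rewrite (introT forallP) // => v; rewrite (iterated_message gx ok R1 srcE).
    have R2 : (1 < #|roots (fun v => next_label (x v))|)%N by rewrite ltnNge R1.
    by rewrite ler_nat (leq_trans _ (ltnW R2)) //; case: forallP.
  by rewrite ExpectD Expect_cst lerD2l Expect_iterated_fails.
by rewrite Expect_cst.
Qed.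

Definition iterates os := nloop (iteration_bits n) iterated_run os.

Lemma Expect_iterates_cons o os x (f : ('I_n -> node) -> rat) :
  Expect (size (o :: os) * iteration_bits n) (fun w => f (iterates (o :: os) w x)) =
  Expect (iteration_bits n) (fun w1 => Expect (size os * iteration_bits n)
    (fun w => f (iterates os w (iterated_run o w1 x)))).
Proof.
exact: (@Expect_split _ (iteration_bits n) (size os * iteration_bits n)
  (fun w1 w => f (iterates os w (iterated_run o w1 x)))).
Qed.

(* Unrolls the recursion [a <- 3/4 a + n M delta] of [Expect_excess]. *)
Lemma Expect_kinds s m K x :
  (forall v, src v = if v == s then Some m else None) -> good x ->
  Expect (size (kinds K) * iteration_bits n) (fun w =>
    (~~ [forall v, message (iterates (kinds K) w x v) == Some m])%:R) <=
  (3 / 4) ^+ K * excess x + (1 + 4 * n%:R * (1 - (3 / 4) ^+ K)) * (M%:R * delta).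
Proof.
move=> srcE; elim: K x => [|K IH] x gx.
  rewrite (Expect_iterates_cons _ _ _
    (fun y => (~~ [forall v, message (y v) == Some m])%:R)).
  rewrite !expr0 mul1r subrr mulr0 addr0 mul1r.
  apply: le_trans _ (Expect_last srcE gx); apply: le_Expect => w.
  rewrite le_eqVlt; apply/orP; left; apply/eqP.
  exact: (@Expect_cst n 0
    (~~ [forall v, message (iterated_run true w x v) == Some m])%:R).
rewrite (Expect_iterates_cons _ _ _
  (fun y => (~~ [forall v, message (y v) == Some m])%:R)).
set c := (1 + _) * _ in IH.
apply: le_trans (le_Expect _ (g := fun w =>
  (3 / 4) ^+ K * excess (iterated_run false w x) + c) _) _ => [w|].
  by apply: IH; apply: iterated_good.
rewrite ExpectD Expect_cst ExpectZ.
apply: le_trans (_ : (3 / 4) ^+ K * (3 / 4 * excess x + n%:R * (M%:R * delta)) + c <= _).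
  by rewrite lerD2r ler_wpM2l ?Expect_excess //; case/andP: (three_quarters K).
rewrite /c exprS le_eqVlt; apply/orP; left; apply/eqP.
by field.
Qed.

Lemma run_broadcast K w :
  run mdl e (fun v => broadcast n K (w v) (src v)) =
  fun v => message (iterates (kinds K) w (fun=> (0%N, Some (0%N, None))) v).
Proof.
rewrite /broadcast run_mapp (run_loop mdl e _ (fun v => iteration n (src v))).
apply: functional_extensionality => v; congr message.
rewrite /iterates; congr (nloop _ _ _ _ _ v).
apply: functional_extensionality => o; apply: functional_extensionality => w'.
by apply: functional_extensionality => x; rewrite run_iteration.
Qed.

Lemma size_ups k : size (ups k) = k.
Proof. by elim: k => //= k ->. Qed.

Lemma size_schedule : M = (3 * n).+1.
Proof. by rewrite /M size_cat /= !size_map size_iota size_ups; lia. Qed.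

Lemma broadcast_failure s m K :
  (forall v, src v = if v == s then Some m else None) ->
  Expect (size (kinds K) * iteration_bits n) (fun w =>
    (~~ [forall v, run mdl e (fun v => broadcast n K (w v) (src v)) v == Some m])%:R) <=
  (3 / 4) ^+ K * n%:R + (1 + 4 * n%:R) * (3 * n%:R + 1) * n%:R * eps.
Proof.
move=> srcE; set x0 : 'I_n -> node := fun=> (0%N, Some (0%N, None)).
have gx : good x0 by [].
rewrite (@eq_Expect _ _ _ (fun w =>
  (~~ [forall v, message (iterates (kinds K) w x0 v) == Some m])%:R)); last first.
  by move=> w; rewrite run_broadcast.
apply: le_trans (Expect_kinds K srcE gx) _; rewrite size_schedule.
have /andP[q0 q1] := three_quarters K.
apply: lerD; first by rewrite ler_wpM2l ?excess_le.
have -> : (3 * n).+1%:R = 3 * n%:R + 1 :> rat by rewrite mulrSr natrM.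
rewrite /delta !mulrA -[leLHS]mulrA -[leLHS]mulrA -[leRHS]mulrA -[leRHS]mulrA.
apply: ler_wpM2r.
  by rewrite !mulr_ge0 ?addr_ge0 ?mulr_ge0 ?ler0n.
by rewrite lerD2l ler_piMr ?mulr_ge0 ?ler0n // gerBl.
Qed.

End Network.
End Clustering.

(** * Local broadcast *)

Section Bernoulli.
Local Open Scope ring_scope.
Implicit Types (q : rat) (d j : nat).

Lemma bernoulli_lower q d : 0 <= q <= 1 -> 1 - d%:R * q <= (1 - q) ^+ d.
Proof.
case/andP=> q0 q1; elim: d => [|d IH]; first by rewrite expr0; lra.
have dq : 0 <= d%:R * q by rewrite mulr_ge0 ?ler0n.
have := ler_wpM2l (_ : 0 <= 1 - q) IH; rewrite -exprS subr_ge0 => /(_ q1).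
by apply: le_trans; rewrite mulrSr; nra.
Qed.

Lemma bernoulli_upper q d : 0 <= q <= 1 -> (1 - q) ^+ d * (1 + d%:R * q) <= 1.
Proof.
case/andP=> q0 q1; elim: d => [|d IH]; first by rewrite expr0; lra.
have dq : 0 <= d%:R * q by rewrite mulr_ge0 ?ler0n.
have p0 : 0 <= (1 - q) ^+ d by rewrite exprn_ge0 // subr_ge0.
apply: le_trans _ IH; rewrite exprSr -mulrA ler_wpM2l // mulrSr; nra.
Qed.

Lemma half_range j : 0 < (2^-1 : rat) ^+ j.+1 <= 2^-1.
Proof.
have h0 : 0 < (2^-1 : rat) by lra.
have h1 : (2^-1 : rat) <= 1 by lra.
by rewrite exprn_gt0 //= exprS ler_piMr ?exprn_ile1 ?ltW.
Qed.

(** The sequence starts at 1/4 and increases, because [1 - h <= (1 - h / 2) ^+ 2]. *)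
Lemma power_ge_quarter j : 1 / 4 <= (1 - (2^-1 : rat) ^+ j.+1) ^+ (2 ^ j.+1).
Proof.
elim: j => [|j IH]; first by rewrite expr1 expn1; lra.
have /andP[h0 h1] := half_range j.
apply: le_trans IH _; rewrite [in leRHS]expnS exprM [(2^-1) ^+ j.+2]exprS.
set h := 2^-1 ^+ j.+1 in h0 h1 *; apply: lerXn2r; rewrite ?nnegrE ?sqr_ge0 //; first by lra.
by rewrite expr2; nra.
Qed.

(** As [d] is at most [2 / q], the power is at least the square of 1/4; the factor [d * q]
    contributes another 1/4. *)
Lemma single_lower q d j : q = 2^-1 ^+ j.+1 -> 1 / 4 <= d%:R * q <= 2 ->
  1 / 64 <= d%:R * q * (1 - q) ^+ d.-1.
Proof.
move=> qE /andP[h1 h2]; have /andP[q0 q1] := half_range j; rewrite -qE in q0 q1.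
have p0 : 0 <= 1 - q by lra.
have p1 : 1 - q <= 1 by lra.
have dj : (d <= 2 ^ j.+1 * 2)%N.
  rewrite -(ler_nat rat) natrM natrX.
  have : d%:R * q * 2 ^+ j.+1 <= 2 * 2 ^+ j.+1 by rewrite ler_wpM2r // exprn_ge0.
  by rewrite qE exprVn mulfVK ?expf_neq0 // [2 * _]mulrC.
have b16 : 1 / 16 <= (1 - q) ^+ d.-1.
  apply: le_trans (_ : (1 - q) ^+ (2 ^ j.+1 * 2) <= _); last first.
    by rewrite ler_wiXn2l // (leq_trans (leq_pred _)).
  rewrite exprM; have := power_ge_quarter j; rewrite -qE => b4.
  by rewrite expr2; nra.
nra.
Qed.

Lemma mixture_le (p0 p1 z u f zb ub : rat) : 0 <= p0 -> p1 <= 1 - p0 ->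
  z <= zb * f -> u <= ub * f ->
  p0 * z + (1 - p0 - p1) * u <= (p0 * zb + (1 - p0 - p1) * ub) * f.
Proof.
move=> p0_ge p01 hz hu; have p2 : 0 <= 1 - p0 - p1 by lra.
by rewrite [leRHS]mulrDl -!mulrA lerD // ler_wpM2l.
Qed.

Lemma le_third (p x : rat) : 0 <= p -> 2 <= x -> p * (1 + x) <= 1 -> p <= 1 / 3.
Proof.
move=> p0 x2; apply: contraTT; rewrite -!ltNge => p13.
by have := ler_wpM2l p0 x2; rewrite mulrDr mulr1; lra.
Qed.

End Bernoulli.

Definition gap c i : nat := (i - c) + (c - i).

(** The threshold is [c.+1] and not [c]: next to [c] a step in either direction is tolerated, since
    there a message arrives with constant probability. *)
Lemma gap_pred c i :
  if i <= c.+1 then gap c i.-1 <= (gap c i).+1 else (gap c i.-1).+1 <= gap c i.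
Proof. by case: ifP; rewrite /gap; lia. Qed.

Lemma gap_succ c i L : c < L -> i < L ->
  if c <= i.+1 then gap c (minn i.+1 L.-1) <= (gap c i).+1
  else (gap c (minn i.+1 L.-1)).+1 <= gap c i.
Proof. by case: ifP; rewrite /gap; lia. Qed.

Lemma next_level i k L : i < L ->
  (if k == 0 then i.-1 else if k == 1 then i else minn i.+1 L.-1) < L.
Proof. by case: ifP => _; [|case: ifP => _]; lia. Qed.

(** * Local broadcast with and without collision detection *)

Section Radio.
Variables (P : eqType) (cd : bool) (R L : nat).

(* Each epoch has one slot per level; a sender transmits in the slot of the
   first [true] among its bits, hence at level [i] with probability
   [2^-(i+1)].  With collision detection a receiver listens at one level only,
   its current position, and moves to rarer (denser) levels upon noise
   (silence). *)
Definition plan (a : action P) (bits : seq bool) (y : nat * option P) (i : nat) :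
    action P :=
  match a with
  | Transmit p => if index true bits == i then Transmit p else Idle
  | Listen => if cd ==> (y.1 == i) then Listen else Idle
  | Idle => Idle
  end.

Definition packet_of (f : feedback P) : option P := if f is FMsg p then Some p else None.

Definition observe (y : nat * option P) (fs : seq (feedback P)) : nat * option P :=
  (match nth FNothing fs y.1 with
   | FNoise => minn y.1.+1 L.-1 | FSilence => y.1.-1 | _ => y.1 end,
   if y.2 is Some p then Some p else ohead (pmap packet_of fs)).

Definition radio_epoch (a : action P) (_ : unit) bits y : prog P (nat * option P) L :=
  mapp (observe y) (epoch (plan a bits y) 0 L).

Definition radio_sr (a : action P) (bits : seq bool) :
    prog P (option P) (size (nseq R tt) * L) :=
  mapp snd (loop L (radio_epoch a) (nseq R tt) bits (0, None)).

(** With collision detection sender and receiver are each active in at most one slot of an epoch. *)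
Lemma cost_plan a bits y :
  \sum_(i <- iota 0 L) cost (plan a bits y i) <=
  (if a is Idle then 0 else if cd then 1 else L).
Proof.
have all_L (F : nat -> nat) : (forall i, F i <= 1) -> \sum_(i <- iota 0 L) F i <= L.
  move=> F1; apply: leq_trans (leq_sum _ (fun i _ => F1 i)) _.
  by rewrite sum1_size size_iota.
have one k : \sum_(i <- iota 0 L) (if k == i then 1 else 0) <= 1.
  rewrite -big_mkcond sum1_count (eq_count (a2 := pred1 k)) => [|i].
    by rewrite count_uniq_mem ?iota_uniq // leq_b1.
  by rewrite /= eq_sym.
case: a => [p||] /=; last by rewrite big1.
  case: cd; last by apply: all_L => i; case: ifP.
  by apply: leq_trans (one (index true bits)); apply: leq_sum => i _; case: ifP.
case: cd => /=; last by apply: all_L.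
by apply: leq_trans (one y.1); apply: leq_sum => i _; case: ifP.
Qed.

Lemma spends_radio a bits :
  spends (if a is Idle then 0 else R * (if cd then 1 else L)) (fun=> True)
    (radio_sr a bits).
Proof.
apply: spends_mapp; set c := if a is Idle then 0 else if cd then 1 else L.
apply: (@spends_weaken _ _ _ (\sum_(o <- nseq R tt) c) _ (fun=> True)) => //.
  rewrite big_const_seq count_predT size_nseq iter_addn_0 mulnC {}/c.
  by case: a => // *; rewrite muln0.
apply: (@spends_loop _ _ _ _ _ _ _ (fun=> c)) => // o bits' y _; apply: spends_mapp.
by apply: spends_weaken (spends_epoch (plan a bits' y) 0 L) => //; apply: cost_plan.
Qed.

Variables (mdl : radio_model) (n : nat) (e : rel 'I_n).
Hypothesis mdlE : mdl = if cd then CD else NoCD.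
Variable a : 'I_n -> action P.

Definition heard (w : 'I_n -> seq bool) (y : 'I_n -> nat * option P) i :=
  fb mdl e (fun u => plan (a u) (w u) (y u) i).

Definition epoch_run (_ : unit) w (y : 'I_n -> nat * option P) v :=
  observe (y v) [seq heard w y i v | i <- iota 0 L].

Definition radio_run w := nloop L epoch_run (nseq R tt) w (fun=> (0, None)).

Lemma run_radio w :
  run mdl e (fun v => radio_sr (a v) (w v)) = fun v => (radio_run w v).2.
Proof.
rewrite /radio_sr run_mapp
  (run_loop mdl e L (fun v => radio_epoch (a v)) (nseq R tt) w (fun=> (0, None))).
apply: functional_extensionality => v; congr (_ _).2.
rewrite /radio_run; congr nloop; apply: functional_extensionality => -[].
apply: functional_extensionality => w'; apply: functional_extensionality => y.
by rewrite /radio_epoch run_mapp run_epoch.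
Qed.

Lemma first_packet (F : nat -> feedback P) s p :
  ohead (pmap packet_of (map F s)) = Some p -> exists i, F i = FMsg p.
Proof.
elim: s => //= i s IH; case E: (F i) => [|||q|] //=; try exact: IH.
by case=> <-; exists i.
Qed.

Lemma first_packet_some (F : nat -> feedback P) s i p : i \in s -> F i = FMsg p ->
  isSome (ohead (pmap packet_of (map F s))).
Proof.
move=> si Fi; elim: s si => //= j s IH; rewrite inE => /orP[/eqP <-|/IH].
  by rewrite Fi.
by case: (F j).
Qed.

Lemma plan_transmits b bits y i p : plan b bits y i = Transmit p -> b = Transmit p.
Proof. by case: b => [q||] //=; case: ifP => // _ [->]. Qed.

Lemma radio_sound w v p :
  run mdl e (fun v => radio_sr (a v) (w v)) v = Some p ->
  exists2 u, e v u & a u = Transmit p.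
Proof.
rewrite run_radio /radio_run.
apply: (@nloop_inv _ _ _ _ (fun y => (y v).2 = Some p -> _)) => // o w' y IH.
rewrite /epoch_run /observe; case yv: (y v).2 => [q|]; first by rewrite -yv.
by case/first_packet=> i /fb_msg[_ [u evu /plan_transmits]]; exists u.
Qed.

Variable v : 'I_n.
Hypothesis listen_v : a v = Listen.

Let S := [set u | e v u && transmits (a u)].

Definition level_senders i (w : 'I_n -> seq bool) := [set u in S | index true (w u) == i].

Lemma hear_size (s : seq P) : (hear mdl s) =
  if size s == 0 then FSilence
  else if size s == 1 then hear mdl s else if cd then FNoise else FSilence.
Proof. by rewrite mdlE; case: cd; case: s => [|q [|? ?]]. Qed.

Lemma hear_one (s : seq P) : size s = 1 -> exists p, hear mdl s = FMsg p.
Proof. by rewrite mdlE; case: cd; case: s => [|q [|? ?]] // _; exists q. Qed.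

Lemma heardE w y i : heard w y i v = if cd ==> ((y v).1 == i) then
  hear mdl (packets e (fun u => plan (a u) (w u) (y u) i) v) else FNothing.
Proof. by rewrite /heard /fb listen_v /=; case: ifP. Qed.

Lemma size_heard w y i :
  size (packets e (fun u => plan (a u) (w u) (y u) i) v) = #|level_senders i w|.
Proof.
rewrite size_packets; apply: eq_card => u; rewrite !inE -andbA; congr (_ && _).
by case: (a u) => [p||] //=; case: ifP.
Qed.

Lemma observe_got w y i : i < L -> cd ==> ((y v).1 == i) -> #|level_senders i w| = 1 ->
  isSome (epoch_run tt w y v).2.
Proof.
move=> iL ci T1; rewrite /epoch_run /observe; case: (y v).2 => //=.
have [p Hp] : exists p, heard w y i v = FMsg p.
  by rewrite heardE ci; apply: hear_one; rewrite size_heard.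
by apply: first_packet_some Hp; rewrite mem_iota.
Qed.

Lemma observe_moves w y : cd -> (y v).1 < L -> let k := #|level_senders (y v).1 w| in
  (epoch_run tt w y v).1 = if k == 0 then (y v).1.-1
    else if k == 1 then (y v).1 else minn (y v).1.+1 L.-1.
Proof.
move=> c yL; rewrite /epoch_run /observe /= (nth_map 0) ?size_iota //.
rewrite nth_iota // add0n heardE eqxx implybT hear_size size_heard.
case: eqP => [//|_]; case: eqP => [T1|_]; last by rewrite c.
by have [|p ->] := @hear_one (packets e (fun u => plan (a u) (w u) (y u) (y v).1) v);
  rewrite ?size_heard.
Qed.

Local Open Scope ring_scope.
Let q i : rat := 2^-1 ^+ i.+1.
Let d := #|S|.

Lemma level_prob_range i : 0 <= q i <= 1.
Proof. by have /andP[h0 h1] := half_range i; rewrite /q (ltW h0) (le_trans h1). Qed.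

Lemma level_sendersE i w u :
  (u \in level_senders i w) = (u \in S) && (index true (w u) == i).
Proof. by rewrite inE. Qed.

Lemma Expect_silent i : (i < L)%N ->
  Expect L (fun w => (#|level_senders i w| == 0)%N%:R) = (1 - q i) ^+ d.
Proof.
move=> iL; pose g u t : rat := if u \in S then (index true t != i)%:R else 1.
rewrite (@eq_Expect _ _ _ (fun w => \prod_u g u (w u))) => [|w].
  rewrite Expect_prod -(prodr_const (mem S)) [RHS]big_mkcond; apply: eq_bigr => u _.
  by rewrite /g; case: ifP; rewrite ?average_not_level ?average_cst.
rewrite cards_eq0; case: eqP => [T0|/eqP/set0Pn[u]]; last first.
  by rewrite level_sendersE => /andP[uS ui]; rewrite (bigD1 u) //= /g uS ui mul0r.
rewrite big1 // => u _; rewrite /g; case: ifP => // uS.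
have : u \notin level_senders i w by rewrite T0 inE.
by rewrite level_sendersE uS => ->.
Qed.

(** The events that [u0] is the only sender at level [i] are disjoint for distinct [u0], and each is
    a product over the vertices. *)
Lemma Expect_single i : (i < L)%N ->
  d%:R * q i * (1 - q i) ^+ d.-1 <=
  Expect L (fun w => (#|level_senders i w| == 1)%N%:R).
Proof.
move=> iL; pose g u0 u t : rat := if u == u0 then (index true t == i)%:R
  else if u \in S then (index true t != i)%:R else 1.
have gE u0 w : u0 \in S -> \prod_u g u0 u (w u) = (level_senders i w == [set u0])%:R.
  move=> u0S; case: eqP => [T1|/eqP nT].
    rewrite big1 // => u _; rewrite /g.
    have := erefl (u \in level_senders i w); rewrite {1}T1 in_set1 level_sendersE.
    case: eqP => [->|_]; first by rewrite u0S /= => <-.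
    by case: ifP => //= uS <-.
  have [u0T|u0T] := boolP (u0 \in level_senders i w); last first.
    rewrite (bigD1 u0) //= /g eqxx; move: u0T; rewrite level_sendersE u0S /= => /negbTE ->.
    by rewrite mul0r.
  have /subsetPn[u uT uu0] : ~~ (level_senders i w \subset [set u0]).
    apply: contra nT => sub; rewrite eqEsubset sub sub1set //.
  move: uT uu0; rewrite level_sendersE in_set1 => /andP[uS ui] uu0.
  by rewrite (bigD1 u) //= /g (negbTE uu0) uS ui mul0r.
apply: le_trans (_ : Expect L (fun w => \sum_(u0 in S) \prod_u g u0 u (w u)) <= _).
  rewrite Expect_sum (eq_bigr (fun=> q i * (1 - q i) ^+ d.-1)) => [|u0 u0S].
    by rewrite sumr_const -[_ *+ #|_|]mulr_natl mulrA.
  rewrite Expect_prod (bigD1 u0) //= {1}/g eqxx average_level //.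
  rewrite (eq_bigr (fun u => if u \in S then 1 - q i else 1)) => [|u uu0]; last first.
    by rewrite /g (negbTE uu0); case: ifP; rewrite ?average_not_level ?average_cst.
  rewrite -big_mkcondr /= (eq_bigl (mem (S :\ u0))) => [|u]; last by rewrite -in_setD1.
  by rewrite prodr_const /d (cardsD1 u0 S) u0S.
apply: le_Expect => w; rewrite (eq_bigr _ (fun u0 => gE u0 w)).
case: (boolP (#|level_senders i w| == 1)%N) => [/cards1P[t ->]|T1]; last first.
  rewrite big1 // => u0 _; case: eqP => // Tu.
  by rewrite Tu cards1 in T1.
rewrite big_mkcond (bigD1 t) //= big1 => [|u ut]; first by case: ifP; rewrite ?eqxx ?addr0.
by case: ifP => // _; rewrite eq_sym (inj_eq set1_inj) (negbTE ut).
Qed.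

Variable c : nat.
(** [c] is the right level: the expected number of senders there lies between 1/2 and 1. *)
Hypotheses (c_lt : (c < L)%N) (c_fits : 1 / 2 <= d%:R * q c /\ d%:R * q c <= 1).

(* Variables, because [done] would evaluate rational literals. *)
Variables A g : rat.
Hypothesis rates : A = 65 / 64 /\ g = 4095 / 4096.
Let dist := gap c.

(* Noise moves a position that is too dense towards [c], silence one that is
   too rare; within one level of [c] a message arrives with constant
   probability. *)
Definition distance_potential (y : 'I_n -> nat * option P) : rat :=
  if isSome (y v).2 then 0 else A ^+ dist (y v).1.

Lemma potential_mono i j : (i <= j)%N -> A ^+ i <= A ^+ j.
Proof. by move=> ij; apply: ler_weXn2l ij; rewrite rates.1; lra. Qed.

Lemma potential_up i j : (i <= j.+1)%N -> A ^+ i <= A * A ^+ j.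
Proof. by move=> ij; rewrite -exprS potential_mono. Qed.

Lemma potential_down i j : (i.+1 <= j)%N -> A ^+ i <= A^-1 * A ^+ j.
Proof.
move=> ij; rewrite ler_pdivlMl //; last by rewrite rates.1; lra.
by rewrite -exprS potential_mono.
Qed.

Lemma rate_le i j : (i <= j)%N -> d%:R * q j <= d%:R * q i.
Proof.
move=> ij; rewrite ler_wpM2l ?ler0n // /q ler_wiXn2l //.
Qed.

Lemma rate_half i : d%:R * q i.+1 = d%:R * q i / 2.
Proof. by rewrite -mulrA -[q i / 2]exprSr. Qed.

(** Here [p0], [p1] are the probabilities of silence and of a message. Above [c.+1] silence has
    probability at least 3/4, and below [c.-1] at most 1/3, so the walk tends towards [c]. In
    between [p1] is at least 1/64, and even if every other move is harmful the factor is
    [63/64 * 65/64], which is [g]. *)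
Lemma drift (p0 p1 z u f : rat) i : (i < L)%N ->
  p0 = (1 - q i) ^+ d -> d%:R * q i * (1 - q i) ^+ d.-1 <= p1 -> p1 <= 1 - p0 ->
  0 < f -> 0 <= z -> 0 <= u ->
  z <= (if (i <= c.+1)%N then A * f else A^-1 * f) ->
  u <= (if (c <= i.+1)%N then A * f else A^-1 * f) ->
  p0 * z + (1 - p0 - p1) * u <= g * f.
Proof.
move=> iL p0E p1E p01 f0 z0 u0; have [c_dense c_rare] := c_fits.
have p0_ge : 0 <= p0 by rewrite p0E exprn_ge0 // subr_ge0; case/andP: (level_prob_range i).
have p1_ge : 0 <= p1.
  apply: le_trans p1E; have /andP[q0 q1] := level_prob_range i.
  by rewrite !mulr_ge0 ?ler0n ?exprn_ge0 // subr_ge0.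
have mix zb ub := @mixture_le p0 p1 z u f zb ub p0_ge p01.
rewrite (_ : A^-1 = 64 / 65); last by rewrite rates.1; lra.
rewrite rates.1 rates.2 => hz hu; move: hz hu; case: (leqP i c.+1) => ic; last first.
  rewrite (leqW (ltnW (ltnW ic))).
  have : 3 / 4 <= p0.
    have := bernoulli_lower d (level_prob_range i); rewrite -p0E.
    have := rate_le ic; rewrite !rate_half; lra.
  move=> p34 hz hu; apply: le_trans (mix _ _ hz hu) _.
  by rewrite (ler_pM2r f0); lra.
case: (leqP c i.+1) => ci hz hu; last first.
  have p13 : p0 <= 1 / 3.
    have X2 : 2 <= d%:R * q i.
      have := rate_le ci.
      rewrite (rate_half i.+1) (rate_half i).
      lra.
    apply: (le_third p0_ge X2).
    rewrite p0E.
    apply: bernoulli_upper.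
    apply: level_prob_range.
  apply: le_trans (mix _ _ hz hu) _.
  by rewrite (ler_pM2r f0); lra.
have : 1 / 64 <= p1.
  apply: le_trans p1E; apply: (single_lower (j := i)) => //; apply/andP; split.
    by have := rate_le ic; rewrite rate_half; lra.
  by have := rate_le ci; rewrite rate_half; lra.
move=> p64; apply: le_trans (mix _ _ hz hu) _.
by rewrite (ler_pM2r f0); lra.
Qed.

Lemma Expect_drift_cd (y : 'I_n -> nat * option P) : cd -> ((y v).1 < L)%N ->
  Expect L (fun w => distance_potential (epoch_run tt w y)) <= g * distance_potential y.
Proof.
move=> hcd yL; rewrite {2}/distance_potential; case yv: (y v).2 => [p|] /=.
  rewrite mulr0 (@eq_Expect _ _ _ (fun=> 0)) ?Expect_cst // => w.
  by rewrite /distance_potential /epoch_run /observe yv.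
set i := (y v).1 in yL *.
set E0 := fun w => (#|level_senders i w| == 0)%N%:R : rat.
set E1 := fun w => (#|level_senders i w| == 1)%N%:R : rat.
pose z := A ^+ dist i.-1; pose u := A ^+ dist (minn i.+1 L.-1).
have -> : Expect L (fun w => distance_potential (epoch_run tt w y)) <= g * A ^+ dist i; last by [].
(* The potential becomes [z] upon silence, 0 upon a message and [u] upon noise, written linearly in
   the first two indicators. *)
apply: le_trans (le_Expect L (g := fun w => (z - u) * E0 w + (u + (- u) * E1 w)) _) _ => [w|].
  have := observe_moves w hcd yL; have := @observe_got w y i yL; rewrite eqxx implybT.
  rewrite /distance_potential /E0 /E1 -/i /=.
  case: eqP => [T0|_] got mv.
    rewrite T0 /= mulr1 mulr0 addr0 subrK mv; case: ifP => // _.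
    by rewrite exprn_ge0 // rates.1; lra.
  case: eqP got mv => [T1|_] got mv.
    by rewrite got // mulr0 add0r mulr1 subrr.
  rewrite mulr0 add0r mulr0 addr0 mv; case: ifP => // _.
  by rewrite exprn_ge0 // rates.1; lra.
rewrite !ExpectD !ExpectZ Expect_cst.
have := @drift (Expect L E0) (Expect L E1) z u (A ^+ dist i) i yL (Expect_silent yL)
  (Expect_single yL).
rewrite mulrBl mulNr => H; apply: le_trans (H _ _ _ _ _ _).
- by rewrite le_eqVlt; apply/orP; left; apply/eqP; ring.
- rewrite lerBrDl -ExpectD -[leRHS](@Expect_cst n L); apply: le_Expect => w.
  by rewrite /E0 /E1; case: eqP => [->|_]; case: eqP => // _; rewrite ?addr0 ?add0r ?ler01.
- by rewrite exprn_gt0 // rates.1; lra.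
- by rewrite exprn_ge0 // rates.1; lra.
- by rewrite exprn_ge0 // rates.1; lra.
- have := gap_pred c i; rewrite /z; case: ifP => _.
    exact: potential_up.
  exact: potential_down.
- have := gap_succ c_lt yL; rewrite /u; case: ifP => _.
    exact: potential_up.
  exact: potential_down.
Qed.

(** The receiver listens at level [c] in every epoch, so it succeeds with probability at least 1/64,
    more than [1 - g]. *)
Lemma Expect_drift_nocd (y : 'I_n -> nat * option P) : ~~ cd ->
  Expect L (fun w => (~~ isSome (epoch_run tt w y v).2)%:R) <=
  g * (~~ isSome (y v).2)%:R.
Proof.
move=> ncd; case yv: (y v).2 => [p|] /=.
  rewrite mulr0 (@eq_Expect _ _ _ (fun=> 0)) ?Expect_cst // => w.
  by rewrite /epoch_run /observe yv.
apply: le_trans (le_Expect L (g := fun w => 1 + (- 1) *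
  (#|level_senders c w| == 1)%N%:R) _) _ => [w|].
  case: eqP => [T1|_]; last by rewrite mulr0 addr0; case: isSome.
  by rewrite (observe_got c_lt _ T1) ?(negbTE ncd) // mulr1 subrr.
rewrite ExpectD ExpectZ Expect_cst; have := Expect_single c_lt.
have [c_dense c_rare] := c_fits.
have := @single_lower (q c) d c erefl; rewrite rates.2; lra.
Qed.

(** The potential dominates the failure indicator and starts at [A ^+ c], since the walk begins at
    level 0. *)
Lemma radio_failure :
  Expect (size (nseq R tt) * L)
    (fun w => (~~ isSome (run mdl e (fun v => radio_sr (a v) (w v)) v))%:R) <=
  g ^+ R * A ^+ L.
Proof.
have A1 k : 1 <= A ^+ k by rewrite exprn_ege1 // rates.1; lra.
rewrite (@eq_Expect _ _ _ (fun w => (~~ isSome (radio_run w v).2)%:R)) => [|w]; last first.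
  by rewrite run_radio.
have g0 : 0 <= g by rewrite rates.2; lra.
have [hcd|ncd] := boolP cd; last first.
  apply: le_trans (@Expect_loop n _ _ L epoch_run (fun=> True)
    (fun y => (~~ isSome (y v).2)%:R) g (nseq R tt) (fun=> (0%N, None)) g0 _ _ I) _ => //.
    by case=> y _; apply: Expect_drift_nocd.
  by rewrite size_nseq mulr1 ler_peMr // exprn_ge0.
apply: le_trans (le_Expect _ (g := fun w => distance_potential (radio_run w)) _) _ => [w|].
  by rewrite /distance_potential; case: isSome.
have L0 : (0 < L)%N by apply: leq_ltn_trans c_lt.
apply: le_trans (@Expect_loop n _ _ L epoch_run (fun y => ((y v).1 < L)%N)
  distance_potential g (nseq R tt) (fun=> (0%N, None)) g0 _ _ L0) _.
- by case=> w y yL; rewrite observe_moves //; apply: next_level.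
- by case=> y; apply: Expect_drift_cd.
rewrite size_nseq ler_wpM2l ?exprn_ge0 //.
by rewrite /distance_potential /= /dist /gap sub0n add0n subn0 potential_mono // ltnW.
Qed.

End Radio.

(** * Local broadcast in LOCAL *)

Section Local.
Variable P : eqType.

Definition local_sr (a : action P) (_ : seq bool) : prog P (option P) 1 :=
  (a, @packet_of P).

Lemma spends_local a bits :
  spends (if a is Idle then 0 else 1) (fun=> True) (local_sr a bits).
Proof. by case: a. Qed.

Variables (n : nat) (e : rel 'I_n) (a : 'I_n -> action P) (w : 'I_n -> seq bool).

Lemma local_sound v p : run LOCAL e (fun v => local_sr (a v) (w v)) v = Some p ->
  exists2 u, e v u & a u = Transmit p.
Proof.
rewrite /= ; case E: (fb LOCAL e a v) => [|||q|] //= [<-].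
by have [_ [u evu au]] := fb_msg E; exists u.
Qed.

Lemma local_complete v : a v = Listen -> [exists u, e v u && transmits (a u)] ->
  isSome (run LOCAL e (fun v => local_sr (a v) (w v)) v).
Proof.
move=> av /existsP[u /andP[evu]]; case au: (a u) => [p||] // _.
have pP : p \in packets e a v by apply/packetsP; exists u.
change (isSome (packet_of (fb LOCAL e a v))).
rewrite /fb av /hear /single_out.
have := some_packet_mem (packets e a v); case: some_packet => //.
by move/eqP=> nil; rewrite nil in pP.
Qed.

End Local.

(** * Choice of parameters *)

Section Numerics.
Local Open Scope ring_scope.

Lemma Expect_card n b (Q : ('I_n -> seq bool) -> bool) :
  Expect b (fun w => (Q w)%:R) =
  #|[set w : {ffun 'I_n -> b.-tuple bool} | Q (fun v => tval (w v))]|%:R /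
  #|{ffun 'I_n -> b.-tuple bool}|%:R.
Proof.
rewrite /Expect; congr (_ / _); rewrite -sum1_card natr_sum [RHS]big_mkcond /=.
by apply: eq_bigr => w _; rewrite inE; case: Q.
Qed.

Lemma half_power_lg (n : nat) : (0 < n)%N -> 0 < (2^-1 : rat) ^+ lg n <= n%:R^-1.
Proof.
move=> n0; have h : 0 < (2 ^+ lg n : rat) by rewrite -natrX ltr0n expn_gt0.
rewrite exprVn invr_gt0 h lef_pV2 ?posrE ?ltr0n //.
by rewrite -natrX ler_nat; apply: up_logP.
Qed.

Lemma three_quarters_half j : (3 / 4 : rat) ^+ (3 * j) <= 2^-1 ^+ j.
Proof.
have h0 : 0 <= (3 / 4 : rat) ^+ 3 by rewrite !exprS expr0; lra.
have h1 : (3 / 4 : rat) ^+ 3 <= 2^-1 by rewrite !exprS expr0; lra.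
by rewrite exprM; apply: lerXn2r; rewrite ?nnegrE // invr_ge0.
Qed.

Lemma polynomial_bound (x : rat) :
  6 <= x -> (1 + 4 * x) * (3 * x + 1) * x <= 20 * x ^+ 3.
Proof.
move=> x6; have x0 : 0 <= x by lra.
have xx := ler_wpM2r x0 x6.
rewrite (_ : 20 * x ^+ 3 = 20 * (x * x) * x); last by ring.
apply: ler_wpM2r x0 _ _ _; lra.
Qed.

(** With [u = 1 / n] the terms are at most [u ^+ k * u] and [u ^+ k * (20 * u ^+ 2)], and
    [u + 20 * u ^+ 2 <= 1] for [u <= 1 / 6]. *)
Lemma failure_sum (n k : nat) : (6 <= n)%N ->
  (3 / 4 : rat) ^+ (3 * ((k + 2) * lg n)) * n%:R +
  (1 + 4 * n%:R) * (3 * n%:R + 1) * n%:R * 2^-1 ^+ ((k + 5) * lg n) <= (n%:R ^+ k)^-1.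
Proof.
move=> n6; have n0 : (0 < n)%N by apply: leq_trans n6.
have /andP[h0 hu] := half_power_lg n0; set x : rat := n%:R in hu *.
have x6 : 6 <= x by rewrite (ler_nat _ 6).
have h0' := ltW h0.
set u := x^-1 in hu; have ux : u * x = 1 by rewrite mulVf //; lra.
have u0 : 0 <= u by rewrite invr_ge0; lra.
have u6 : u <= 1 / 6 by have := ler_wpM2l u0 x6; rewrite ux; lra.
have pw j : (2^-1 : rat) ^+ ((k + j) * lg n) <= u ^+ k * u ^+ j.
  rewrite mulnC exprM -exprD; apply: lerXn2r => //.
have e1 : (3 / 4 : rat) ^+ (3 * ((k + 2) * lg n)) * x <= u ^+ k * u.
  apply: le_trans (_ : u ^+ k * u ^+ 2 * x <= _); last by rewrite -mulrA expr2 -mulrA ux mulr1.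
  rewrite ler_wpM2r //.
  exact: le_trans (three_quarters_half _) (pw 2%N).
have e2 : (1 + 4 * x) * (3 * x + 1) * x * 2^-1 ^+ ((k + 5) * lg n) <= u ^+ k * (20 * u ^+ 2).
  apply: le_trans (_ : 20 * x ^+ 3 * (u ^+ k * u ^+ 5) <= _).
    apply: ler_pM (pw 5%N); first by rewrite !mulr_ge0 ?addr_ge0; lra.
      by rewrite exprn_ge0 ?invr_ge0.
    exact: polynomial_bound.
  rewrite (_ : 20 * x ^+ 3 * (u ^+ k * u ^+ 5) = u ^+ k * (20 * u ^+ 2) * (u * x) ^+ 3).
    by rewrite ux expr1n mulr1.
  ring.
rewrite -exprVn -/u; apply: le_trans (lerD e1 e2) _.
rewrite -mulrDr ler_piMr ?exprn_ge0 //; nra.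
Qed.

Lemma bernoulli_half (q : rat) (d : nat) :
  0 <= q <= 1 -> d%:R * q = 1 -> (1 - q) ^+ d <= 2^-1.
Proof.
by move=> q01 dq; have := bernoulli_upper d q01; rewrite dq; lra.
Qed.

(** The exponent [2 ^ 12] works; behind the existential it is never evaluated. *)
Lemma halving_exponent : exists C : nat, (4095 / 4096 : rat) ^+ C <= 2^-1.
Proof.
have q01 : 0 <= (1 / 4096 : rat) <= 1 by apply/andP; split; lra.
have [d dq] : exists d : nat, d%:R * (1 / 4096) = 1 :> rat.
  by exists (2 ^ 12)%N; rewrite natrX !exprS expr0; lra.
have gE : (4095 / 4096 : rat) = 1 - 1 / 4096 by lra.
by exists d; rewrite gE; apply: bernoulli_half q01 dq.
Qed.

(** The initial potential is at most [2 ^+ lg n], which uses up one of the [k + 6] factors. *)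
Lemma radio_eps C k (A g : rat) (n L : nat) : A = 65 / 64 /\ g = 4095 / 4096 ->
  g ^+ C <= 2^-1 -> (L <= lg n)%N ->
  g ^+ (C * ((k + 6) * lg n)) * A ^+ L <= 2^-1 ^+ ((k + 5) * lg n).
Proof.
case=> AE gE gC Ln.
have g0 : 0 <= g by rewrite gE; lra.
have A0 : 0 <= A by rewrite AE; lra.
have A1 : 1 <= A by rewrite AE; lra.
have A2 : A <= 2 by rewrite AE; lra.
move: A g g0 A0 A1 A2 gC {AE gE} => A g g0 A0 A1 A2 gC.
have h0 : 0 <= (2^-1 : rat) by rewrite invr_ge0.
apply: le_trans (_ : 2^-1 ^+ ((k + 6) * lg n) * 2 ^+ lg n <= _).
  apply: ler_pM; rewrite ?exprn_ge0 //.
    by rewrite exprM; apply: lerXn2r; rewrite ?nnegrE ?exprn_ge0.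
  apply: le_trans (_ : A ^+ lg n <= _); first by apply: ler_weXn2l.
  by apply: lerXn2r; rewrite ?nnegrE.
rewrite (_ : (k + 6) * lg n = (k + 5) * lg n + lg n)%N; last by lia.
by rewrite exprD -mulrA -exprMn mulVf // expr1n mulr1.
Qed.

Lemma fitting_level d L : (0 < d)%N -> (d <= 2 ^ L)%N -> (0 < L)%N ->
  exists2 c : nat, (c < L)%N &
    1 / 2 <= d%:R * (2^-1 : rat) ^+ c.+1 /\ d%:R * (2^-1 : rat) ^+ c.+1 <= 1.
Proof.
move=> d0 dL L0.
have [c cL /andP[c1 c2]] : exists2 c, (c < L)%N & (d <= 2 ^ c.+1 <= d * 2)%N.
  case: (ltnP 1 d) => d1; last first.
    by exists 0%N => //; rewrite (_ : d = 1%N) //; apply/eqP; rewrite eqn_leq d1.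
  have u0 : (0 < up_log 2 d)%N by rewrite up_log_gt0.
  exists (up_log 2 d).-1; rewrite ?prednK //; first exact: up_log_min.
  rewrite up_logP //= -(prednK u0) expnS mulnC leq_mul2r ltnW ?orbT //.
  exact: up_log_gtn.
exists c => //; set y : rat := 2 ^+ c.+1.
have y0 : 0 < y by rewrite exprn_gt0.
have : d%:R <= y by rewrite /y -natrX ler_nat.
have : y <= d%:R * 2 by rewrite /y -natrX -natrM ler_nat.
rewrite exprVn -/y => h1 h2; split; last by rewrite ler_pdivrMr // mul1r.
by rewrite ler_pdivlMr //; lra.
Qed.

End Numerics.

(** Ensures that [lg D] is positive. If degrees were at most 1, some edge would leave the closed
    neighbourhood of [v0], and its inner end would have two neighbours. *)
Lemma two_le_max_degree n D (e : rel 'I_n) : 3 <= n -> graph_ok D e -> 1 < D.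
Proof.
move=> n3 [sym [irr [conn maxD]]].
have degD v : #|[set u | e v u]| <= D by rewrite -maxD; apply: leq_bigmax.
have v0 : 'I_n by apply: (@Ordinal n 0); apply: leq_trans n3.
rewrite ltnNge; apply/negP => D1.
pose Q := v0 |: [set u | e v0 u].
have [v vQ] : exists v, v \notin Q.
  apply/existsP; rewrite -negb_forall; apply/negP => /forallP all_Q.
  have : #|'I_n| <= #|Q| by apply/subset_leq_card/subsetP => u _; apply: all_Q.
  rewrite card_ord /Q cardsU1 => nQ.
  have := leq_trans n3 nQ; have := leq_trans (degD v0) D1.
  by case: (_ \notin _); lia.
have v0Q : v0 \in Q by rewrite !inE eqxx.
have [x [y [exy xQ yQ]]] := connect_crossing (Q := fun u => u \in Q) (conn v0 v) v0Q (negP vQ).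
move/negP: yQ; rewrite !inE negb_or => /andP[yv0 nv0y].
move: xQ; rewrite !inE => /orP[/eqP xv0|v0x]; first by rewrite -xv0 exy in nv0y.
have : [set v0; y] \subset [set u | e x u].
  by apply/subsetP => u; rewrite !inE => /orP[/eqP->|/eqP->] //; rewrite sym.
move/subset_leq_card; rewrite cards2 eq_sym yv0 => h.
by have := leq_trans h (leq_trans (degD x) D1).
Qed.

(** * The broadcast algorithm and its bounds in the three models *)

Section Assembly.
Variables (mdl : radio_model) (k : nat) (Msg : eqType).
Let pkt : eqType := (nat * option Msg)%type.
Variables (B b E : nat -> nat -> nat).
Variable sr : forall n D : nat, action pkt -> seq bool -> prog pkt (option pkt) (B n D).

(** Three iterations at least halve the expected excess, as [(3 / 4) ^+ 3 <= 1 / 2]. *)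
Definition iteration_count n := 3 * ((k + 2) * lg n).

Definition broadcast_algorithm : algorithm Msg :=
  compile (fun n D => size (kinds (iteration_count n)) * iteration_bits (b n D) n)
    (fun n D bits src => broadcast (b n D) (@sr n D) n (iteration_count n) bits src).

Hypothesis sr_energy : forall n D a bits,
  spends (if a is Idle then 0 else E n D) (fun=> True) (@sr n D a bits).
Hypothesis sr_sound : forall n D (e : rel 'I_n) a w v p, a v = Listen ->
  sr_run (@sr n D) mdl e a w v = Some p -> exists2 u, e v u & a u = Transmit p.
Hypothesis sr_fail : forall n D (e : rel 'I_n) a v, 6 <= n -> graph_ok D e ->
  a v = Listen -> [exists u, e v u && transmits (a u)] ->
  (Expect (b n D) (fun w => (~~ isSome (sr_run (@sr n D) mdl e a w v))%:R) <=
   (2^-1) ^+ ((k + 5) * lg n))%R.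

Lemma broadcast_algorithm_rounds n D :
  rounds broadcast_algorithm n D = (iteration_count n).+1 * ((3 * n).+1 * B n D).
Proof.
rewrite /= /kinds size_cat size_nseq addn1 -mulnDl /gather size_cat /= !size_map.
by rewrite !size_iota size_ups; congr (_ * (_ * _)); lia.
Qed.

Lemma broadcast_algorithm_energy n D (e : rel 'I_n) s m rnd v :
  energy broadcast_algorithm mdl D e s m rnd (rounds broadcast_algorithm n D) v <=
  (iteration_count n).+1 * (E n D * 7).
Proof.
apply: compile_energy; apply: spends_broadcast => a bits; exact: sr_energy.
Qed.

Lemma broadcast_algorithm_failure n D (e : rel 'I_n) s m : 6 <= n -> graph_ok D e ->
  #|[set rnd : {ffun 'I_n -> (rbits broadcast_algorithm n D).-tuple bool} |
      ~~ [forall v, out (exec broadcast_algorithm mdl D e s m (fun u => tval (rnd u))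
                           (rounds broadcast_algorithm n D) v) == Some m]]| * n ^ k
    <= #|{ffun 'I_n -> (rbits broadcast_algorithm n D).-tuple bool}|.
Proof.
move=> n6 G; have [sym [_ [conn _]]] := G.
have n0 : (0 < n%:R ^+ k :> rat)%R by rewrite exprn_gt0 // ltr0n (leq_trans _ n6).
set r := rbits _ n D; have N0 : (0 < #|{ffun 'I_n -> r.-tuple bool}|%:R :> rat)%R.
  by rewrite lt_neqAle eq_sym card_bits_neq0 ler0n.
have e0 : (0 <= 2^-1 ^+ ((k + 5) * lg n) :> rat)%R by rewrite exprn_ge0 ?invr_ge0.
have := broadcast_failure (@sr_sound n D e) sym conn e0
  (fun a v => @sr_fail n D e a v n6 G) (iteration_count n)
  (src := fun v => if v == s then Some m else None) (fun v => erefl).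
move=> /le_trans/(_ (failure_sum k n6)).
rewrite Expect_card -(ler_nat rat) natrM natrX ler_pdivrMr // mulrC ler_pdivlMr //.
apply: le_trans; rewrite le_eqVlt; apply/orP; left; apply/eqP.
congr (_%:R * _)%R; apply: eq_card => w; rewrite !inE; congr (~~ _).
by apply: eq_forallb => v; rewrite [rounds _ _ _]/= compile_out.
Qed.

End Assembly.

Lemma iteration_count_le k n : 2 <= n -> (iteration_count k n).+1 <= (3 * k + 7) * lg n.
Proof.
move=> n2; have : 0 < lg n by rewrite up_log_gt0.
rewrite /iteration_count; nia.
Qed.

Lemma broadcast_local :
  broadcast_whp LOCAL (fun n _ => n * lg n) (fun n _ => lg n).
Proof.
(* The factor [3 * k + 7] bounds the iterations per [lg n]; 7 counts the local broadcasts of a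
   vertex per iteration, and also covers [3 * n + 1 <= 7 * n] for the time. *)
move=> k; exists (7 * (3 * k + 7)), 6 => Msg.
exists (broadcast_algorithm k (B := fun _ _ => 1) (fun _ _ => 0)
  (fun _ _ => @local_sr (nat * option Msg)%type)) => n D n6.
have K := @iteration_count_le k n (leq_trans (isT : 2 <= 6) n6).
split=> [|e s m G].
  rewrite broadcast_algorithm_rounds muln1.
  apply: leq_trans (leq_mul K (leqnn _)) _.
  have : (3 * n).+1 <= 7 * n by lia.
  move=> /(leq_mul (leqnn ((3 * k + 7) * lg n))) /leq_trans; apply.
  by rewrite leq_eqVlt; apply/orP; left; apply/eqP; ring.
split=> [rnd v|].
  apply: leq_trans (@broadcast_algorithm_energy LOCAL k Msg _ _ (fun _ _ => 1) _ _
    n D e s m _ v) _ => [? ? a bits|]; first exact: spends_local.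
  by rewrite mul1n mulnC -mulnA leq_mul2l K orbT.
apply: broadcast_algorithm_failure => // {n D n6 K e s m G}.
  by move=> n D e a w v p _; apply: local_sound.
move=> n D e a v n6 G av sv.
rewrite (@eq_Expect _ _ _ (fun=> 0%R)) => [|w].
  by rewrite Expect_cst exprn_ge0 // invr_ge0.
by rewrite /sr_run local_complete.
Qed.

Lemma broadcast_radio cd :
  broadcast_whp (if cd then CD else NoCD) (fun n D => n * lg D * lg n ^ 2)
    (fun n D => if cd then lg n ^ 2 else lg D * lg n ^ 2).
Proof.
move=> k; have [C HC] := halving_exponent.
(* Compared with LOCAL, each local broadcast takes [C * (k + 6) * lg n] epochs. *)
exists (7 * (3 * k + 7) * (C * (k + 6))), 6 => Msg.
pose R n := C * ((k + 6) * lg n).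
exists (broadcast_algorithm k (B := fun n D => size (nseq (R n) tt) * lg D)
  (fun n D => size (nseq (R n) tt) * lg D)
  (fun n D => @radio_sr (nat * option Msg)%type cd (R n) (lg D))) => n D n6.
have K := @iteration_count_le k n (leq_trans (isT : 2 <= 6) n6).
split=> [|e s m G].
  rewrite broadcast_algorithm_rounds size_nseq.
  apply: leq_trans (leq_mul K (leqnn _)) _.
  have : (3 * n).+1 <= 7 * n by lia.
  move=> /(fun h => leq_mul h (leqnn (R n * lg D))).
  move=> /(leq_mul (leqnn ((3 * k + 7) * lg n))) /leq_trans; apply.
  by rewrite leq_eqVlt; apply/orP; left; apply/eqP; rewrite /R; ring.
split=> [rnd v|].
  apply: leq_trans (@broadcast_algorithm_energy _ k Msg _ _
    (fun n D => R n * (if cd then 1 else lg D)) _ _ n D e s m _ v) _ => [? ? a bits|].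
    exact: spends_radio.
  apply: leq_trans (leq_mul K (leqnn _)) _.
  rewrite leq_eqVlt; apply/orP; left; apply/eqP; rewrite /R.
  by case: (cd); ring.
apply: broadcast_algorithm_failure => // {n D n6 K e s m G}.
  by move=> n D e a w v p _; apply: radio_sound.
move=> n D e a v n6 G av sv; rewrite /sr_run.
have D2 : 1 < D by apply: two_le_max_degree G; apply: leq_trans n6.
have [_ [_ [_ maxD]]] := G.
have d0 : 0 < #|[set u | e v u & transmits (a u)]|.
  by case/existsP: sv => u uS; apply/card_gt0P; exists u; rewrite inE.
have dD : #|[set u | e v u & transmits (a u)]| <= D.
  rewrite -maxD; apply: leq_trans (leq_bigmax v).
  by apply/subset_leq_card/subsetP => u; rewrite !inE => /andP[].
have Dn : D <= n.
  by rewrite -maxD; apply/bigmax_leqP => u _; rewrite -[leqRHS]card_ord max_card.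
have L0 : 0 < lg D by rewrite up_log_gt0.
have [c cL Hc] := fitting_level d0 (leq_trans dD (@up_logP 2 D isT)) L0.
apply: le_trans (radio_failure (R n) erefl av cL Hc (conj erefl erefl)) _.
exact: radio_eps (conj erefl erefl) HC (leq_up_log 2 Dn).
Qed.

Theorem theorem4 :
  broadcast_whp LOCAL (fun n _ => n * lg n) (fun n _ => lg n) /\
  broadcast_whp CD (fun n Delta => n * lg Delta * (lg n) ^ 2) (fun n _ => (lg n) ^ 2) /\
  broadcast_whp NoCD (fun n Delta => n * lg Delta * (lg n) ^ 2)
                     (fun n Delta => lg Delta * (lg n) ^ 2).
Proof.
split; first exact: broadcast_local.
by split; [exact: (broadcast_radio true) | exact: (broadcast_radio false)].
Qed.
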